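(* For every finite connected $(v_3)$ graph $G$ there is a finite sequence $G=G_0,G_1,\dots,G_k$ ($k\ge 0$) of connected $(v_3)$ graphs such that each $G_{i+1}$ is obtained from $G_i$ by a reduction (by some black vertex and some white vertex of $G_i$), and $G_k$ is isomorphic either to the Heawood graph or to the Pappus graph.
   Context: A $(v_3)$ graph is a finite simple bipartite cubic (3-regular) graph of girth at least $6$; its two colour classes are called black and white. Reduction of a bipartite cubic graph $G$ by a black vertex $u$ and a white vertex $v$: delete $u$ and $v$ and join their remaining neighbours so that the result is again cubic and bipartite. Precisely, if $u$ and $v$ are non-adjacent, $u$ has white neighbours $a_1,a_2,a_3$ and $v$ has black neighbours $b_1,b_2,b_3$, and one adds the three edges of a perfect matching between $\{a_1,a_2,a_3\}$ and $\{b_1,b_2,b_3\}$; if $u$ and $v$ are adjacent, $u$ has further neighbours $a_1,a_2$ and $v$ has further neighbours $b_1,b_2$, and one adds the two edges of a perfect matching between $\{a_1,a_2\}$ and $\{b_1,b_2\}$. The Heawood graph is the incidence graph of the Fano plane (14 vertices; LCF notation $[5,-5]^7$). The Pappus graph is the incidence graph of the Pappus $(9_3)$ configuration (18 vertices; LCF notation $[5,7,-7,7,-7,-5]^3$). *)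

(* Defs.v *)
From mathcomp Require Import all_boot.
Set Implicit Arguments. Unset Strict Implicit. Unset Printing Implicit Defensive.

(* A finite graph with a 2-colouring: colour [true] = black, [false] = white. *)
Record cgraph := CGraph {
  cV :> finType;
  cadj : rel cV;
  ccol : cV -> bool }.

Definition simple_graph (V : finType) (e : rel V) : Prop :=
  (forall x y, e x y = e y x) /\ (forall x, ~~ e x x).

Definition cubic (V : finType) (e : rel V) : Prop :=
  forall x : V, #|[set y | e x y]| = 3.

Definition girth_ge6 (V : finType) (e : rel V) : Prop :=
  forall c : seq V, uniq c -> cycle e c -> 3 <= size c -> 6 <= size c.

Definition v3 (G : cgraph) : Prop :=
  [/\ simple_graph (@cadj G),
      (forall x y : G, cadj x y -> ccol x != ccol y),
      cubic (@cadj G) & girth_ge6 (@cadj G)].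

Definition gconnected (G : cgraph) : Prop :=
  0 < #|G| /\ forall x y : G, connect (@cadj G) x y.

(* The graph G' is obtained from G by reduction by black u and white v:
   m is a perfect matching (bijection) from N(u)\{v} onto N(v)\{u};
   G' is (a copy of) the graph on V(G)\{u,v} with the old edges plus the
   matching edges, with inherited colours. *)
Definition red_added (G : cgraph) (u v : G) (m : G -> G) (x y : G) : bool :=
  [&& cadj u x, x != v & m x == y].

Definition reduction_step (G G' : cgraph) : Prop :=
  exists (u v : G) (m : G -> G),
    [/\ ccol u /\ ~~ ccol v,
        (forall a, cadj u a -> a != v -> cadj v (m a) /\ m a != u),
        (forall a b, cadj u a -> a != v -> cadj u b -> b != v ->
                      m a = m b -> a = b),
        (forall b, cadj v b -> b != u -> exists a, [/\ cadj u a, a != v & m a = b]) &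
    (exists f : G' -> G,
      [/\ injective f,
          (forall x, f x != u /\ f x != v),
          (forall y, y != u -> y != v -> exists x, f x = y),
          (forall x y, cadj x y = [|| cadj (f x) (f y), red_added u v m (f x) (f y)
                                    | red_added u v m (f y) (f x)]) &
          (forall x, ccol x = ccol (f x))])].

(* chain G = G_0, ..., G_k = H of connected (v_3) graphs, each a reduction
   of the previous (G_0 itself is assumed connected (v_3) separately) *)
Inductive reduces_to : cgraph -> cgraph -> Prop :=
  | red_refl G : reduces_to G G
  | red_step G G' H : reduction_step G G' -> v3 G' -> gconnected G' ->
      reduces_to G' H -> reduces_to G H.

(* graphs given by LCF notation on Z_n: vertex i is joined to i+1 and to
   i + off i (mod n), where off i is the LCF jump taken modulo n *)
Definition lcf_adj (n : nat) (off : nat -> nat) : rel 'I_n :=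
  fun i j =>
    [|| (j == (i + 1) %% n :> nat), (i == (j + 1) %% n :> nat),
        (j == (i + off i) %% n :> nat) | (i == (j + off j) %% n :> nat)].

(* Heawood graph: LCF [5,-5]^7 on 14 vertices *)
Definition heawood_adj : rel 'I_14 :=
  @lcf_adj 14 (fun i => if odd i then 9 else 5).

(* Pappus graph: LCF [5,7,-7,7,-7,-5]^3 on 18 vertices *)
Definition pappus_off (i : nat) : nat :=
  match i %% 6 with
  | 0 => 5 | 1 => 7 | 2 => 11 | 3 => 7 | 4 => 11 | _ => 13 end.
Definition pappus_adj : rel 'I_18 := @lcf_adj 18 pappus_off.

Definition isomorphic_to (G : cgraph) (n : nat) (e : rel 'I_n) : Prop :=
  exists f : G -> 'I_n, bijective f /\ forall x y, cadj x y = e (f x) (f y).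

(* Main.v *)
(** Suppose that no reduction of [G] yields a connected (v_3) graph. A cubic
bipartite graph has no bridge (count edges modulo 3), and a 2-edge cut would allow
a reduction by the two ends of one well chosen edge; without 2-edge cuts every
reduction is connected, so every reduction of [G] must create a double edge or a
square. This is a local condition: whatever [u], [v] and the perfect matching
between their neighbourhoods, either some matched [a], [b] are joined by a path
[a x y b] avoiding [u] and [v], or two matched pairs [a, b] and [a', b'] satisfy
[a ~ b'] and [a' ~ b]. Growing a finite piece of [G] from one vertex, and branching
over the possible new neighbours of a vertex and over the possible paths [a x y b],
gives a finite search tree whose only leaves that are not contradictory are the
Heawood and the Pappus graph. *)
Require Import Defs.
From mathcomp Require Import all_boot.
From Stdlib Require Import Classical.

Set Implicit Arguments. Unset Strict Implicit. Unset Printing Implicit Defensive.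

(** * Reductions of (v_3) graphs *)

(** Let [ua] and [vb] be the edges of a 2-edge cut, with [a] and [b] on the same side. The edge to
    reduce by is [ab] or [uv] if one of them is present, and [ua] otherwise. All new edges can then
    be made to cross the cut, so a double edge or a square through one of them would need a further
    crossing edge, and none fits; a disconnected result would expose a bridge of [G]. Without such
    cuts connectedness follows by pigeonhole: each of the at most three new edges stays within one
    component, so if the reduced graph splits in two, one side holds at most one new edge and hangs
    on the deleted vertices by at most two edges of [G]. A pattern of the search records known edges
    and never non-edges; non-adjacency is inferred from saturated vertices and from the girth. Hence
    a settled pattern settles every pattern containing a copy of it, and the tree can share
    subtrees. Nothing is argued in advance about the size or finiteness of the search: each move is
    proved sound, and a recorded tree is replayed by evaluation. *)

Section V3Facts.
Variable G : cgraph.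
Hypothesis vG : v3 G.

Lemma v3_adjC (x y : G) : cadj x y = cadj y x.
Proof. by have [[sym _] _ _ _] := vG; apply: sym. Qed.

Lemma v3_adj_neq (x y : G) : cadj x y -> x != y.
Proof. by have [[_ irr] _ _ _] := vG; apply: contraTneq => ->; apply: irr. Qed.

Lemma v3_adj_col (x y : G) : cadj x y -> ccol y = ~~ ccol x.
Proof. by have [_ col _ _] := vG; move/col; case: (ccol x) (ccol y) => [] []. Qed.

Lemma v3_card_nbrs (x : G) : #|[set y | cadj x y]| = 3.
Proof. by have [_ _ c3 _] := vG; apply: c3. Qed.

Lemma v3_no_square (x y a b : G) :
  x != y -> cadj x a -> cadj y a -> cadj x b -> cadj y b -> a = b.
Proof.
move=> xy xa ya xb yb; apply/eqP/negP => /negP ab.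
have [_ _ _ girth] := vG.
have [xNa yNa xNb yNb] := And4 (v3_adj_neq xa) (v3_adj_neq ya) (v3_adj_neq xb) (v3_adj_neq yb).
suff: 6 <= size [:: x; a; y; b] by [].
apply: girth => //=; last by rewrite xa v3_adjC ya yb v3_adjC xb.
by rewrite !inE !negb_or xNa xy xNb yNb ab eq_sym yNa.
Qed.

Lemma v3_adj_mem (x : G) (s : seq G) :
  size s = 3 -> uniq s -> all (cadj x) s -> forall y, cadj x y = (y \in s).
Proof.
move=> s3 us /allP xs y.
have sub : [set z in s] \subset [set z | cadj x z].
  by apply/subsetP => z; rewrite !inE => /xs.
have /eqP E : [set z in s] == [set z | cadj x z].
  by rewrite eqEcard sub v3_card_nbrs cardsE (card_uniqP us) s3.
by move/setP/(_ y): E; rewrite !inE.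
Qed.

Lemma v3_new_nbr (x : G) (s : seq G) :
  size s < 3 -> exists2 y, cadj x y & y \notin s.
Proof.
move=> s3; have: ~~ ([set y | cadj x y] \subset [set y in s]).
  apply/negP => /subset_leq_card; rewrite v3_card_nbrs cardsE leqNgt => /negP; apply.
  exact: leq_ltn_trans (card_size s) s3.
by case/subsetPn => y; rewrite !inE => xy ys; exists y.
Qed.

End V3Facts.

(** Cycles of length 3 and 5 contradict the 2-colouring, so girth 6 comes down to the absence of
    squares. *)
Lemma v3_intro (G : cgraph) :
  simple_graph (@cadj G) -> (forall x y : G, cadj x y -> ccol x != ccol y) ->
  cubic (@cadj G) ->
  (forall x y a b : G, x != y -> a != b ->
     cadj x a -> cadj a y -> cadj y b -> cadj b x -> False) ->
  v3 G.
Proof.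
move=> simp col c3 no4; split=> // c uc cc.
have sym := simp.1.
case: c uc cc => [|x [|a [|y [|b [|c s]]]]] //=.
- by move=> _ /and4P[/col + /col + /col + _] _; case: (ccol x) (ccol a) (ccol y) => [] [] [].
- rewrite !inE !negb_or => /and4P[/and3P[_ xy _] /andP[_ ab] _ _] /and5P[xa ay yb bx _] _.
  by case: (no4 x y a b).
- case: s => //= _ /and5P[/col + /col + /col + /col + /andP[/col + _]] _.
  by case: (ccol x) (ccol a) (ccol y) (ccol b) (ccol c) => [] [] [] [] [].
Qed.

(** A list of pairs treats both kinds of reduction alike: for adjacent [u] and [v] the conditions
    [a != v] and [b != u] leave two pairs, otherwise they are vacuous and leave three. Reversing the
    pairs exchanges the roles of [u] and [v]. *)
Definition is_matching (G : cgraph) (u v : G) (ms : seq (G * G)) : Prop :=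
  [/\ uniq (unzip1 ms), uniq (unzip2 ms),
      (forall a, (a \in unzip1 ms) = cadj u a && (a != v)) &
      (forall b, (b \in unzip2 ms) = cadj v b && (b != u))].

(* No square of the reduced graph uses one (first clause) or two (second
   clause) of the new edges; the first clause also excludes double edges. *)
Definition admissible (G : cgraph) (u v : G) (ms : seq (G * G)) : Prop :=
  (forall a b x y, (a, b) \in ms ->
     cadj a x -> x != u -> cadj b y -> y != v -> ~~ cadj x y) /\
  (forall a b a' b', (a, b) \in ms -> (a', b') \in ms -> a != a' ->
     cadj a b' -> cadj a' b -> False).

Definition irreducible (G : cgraph) : Prop :=
  forall G', reduction_step G G' -> v3 G' -> gconnected G' -> False.

Lemma matching_swap (G : cgraph) (u v : G) ms :
  is_matching u v ms -> is_matching v u [seq (p.2, p.1) | p <- ms].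
Proof.
have e1 : unzip1 [seq (p.2, p.1) | p <- ms] = unzip2 ms by rewrite /unzip1 -map_comp.
have e2 : unzip2 [seq (p.2, p.1) | p <- ms] = unzip1 ms by rewrite /unzip2 -map_comp.
by case=> u1 u2 m1 m2; rewrite /is_matching e1 e2.
Qed.

Lemma mem_swap (T U : eqType) (ms : seq (T * U)) a b :
  ((b, a) \in [seq (p.2, p.1) | p <- ms]) = ((a, b) \in ms).
Proof.
apply/mapP/idP => [[[a' b'] /= h [-> ->]] //|h]; by exists (a, b).
Qed.

(** * The reduced graph is again a (v_3) graph *)

Section Reduce.
Variables (G : cgraph) (u v : G) (ms : seq (G * G)).
Hypotheses (vG : v3 G) (cu : ccol u) (cv : ~~ ccol v).
Hypotheses (mM : is_matching u v ms) (adm : admissible u v ms).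

(** The functional form that [reduction_step] asks for. The default pair makes it the identity off
    the matched vertices, where [red_added] is false anyway. *)
Let m (a : G) : G := (nth (a, a) ms (index a (unzip1 ms))).2.

Lemma matching_fun (a b : G) : ((a, b) \in ms) = (a \in unzip1 ms) && (m a == b).
Proof.
have [u1 _ _ _] := mM; apply/idP/andP => [h|[h /eqP<-]].
  split; first by apply/mapP; exists (a, b).
  have lt := h; rewrite -index_mem in lt.
  have -> : m a = (nth (a, a) ms (index (a, b) ms)).2.
    rewrite /m; congr (nth _ _ _).2.
    rewrite -{1}[a]/((a, b).1) -{1}(nth_index (a, a) h) -(nth_map _ a) //.
    by rewrite index_uniq // size_map.
  by rewrite nth_index.
have lt : index a (unzip1 ms) < size ms by rewrite -(size_map fst) index_mem.
have <- : nth (a, a) ms (index a (unzip1 ms)) = (a, m a).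
  rewrite [LHS]surjective_pairing; congr (_, _).
  by rewrite -(nth_map _ a) // nth_index.
exact: mem_nth.
Qed.

Lemma matching_mem (a b : G) : (a, b) \in ms ->
  [/\ cadj u a, a != v, cadj v b & b != u].
Proof.
have [_ _ m1 m2] := mM => h.
have: a \in unzip1 ms by apply/mapP; exists (a, b).
have: b \in unzip2 ms by apply/mapP; exists (a, b).
by rewrite m1 m2 => /andP[-> ->] /andP[-> ->].
Qed.

Lemma matching_funct (a b b' : G) : (a, b) \in ms -> (a, b') \in ms -> b = b'.
Proof. by rewrite !matching_fun => /andP[_ /eqP<-] /andP[_ /eqP<-]. Qed.

Lemma matching_inj (a a' b : G) : (a, b) \in ms -> (a', b) \in ms -> a = a'.
Proof.
have [_ u2 _ _] := mM => h h'.
have [l l'] : index (a, b) ms < size ms /\ index (a', b) ms < size ms by rewrite !index_mem.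
suff E : index (a, b) ms = index (a', b) ms.
  by have := nth_index (a, b) h; rewrite E nth_index // => -[->].
apply/eqP; rewrite -(nth_uniq b _ _ u2) ?size_map // !(nth_map (a, b)) // nth_index //.
by rewrite nth_index.
Qed.

Lemma red_addedE x y : red_added u v m x y = ((x, y) \in ms).
Proof. by rewrite matching_fun; have [_ _ -> _] := mM; rewrite /red_added -andbA. Qed.

Let V := {x : G | (x != u) && (x != v)}.

Definition reduced : cgraph :=
  @CGraph V (fun x y => [|| cadj (val x) (val y), red_added u v m (val x) (val y)
                          | red_added u v m (val y) (val x)]) (fun x => ccol (val x)).

Lemma reduced_adj (x y : reduced) :
  cadj x y = [|| cadj (val x) (val y), (val x, val y) \in ms | (val y, val x) \in ms].
Proof. by rewrite /= !red_addedE. Qed.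

Lemma reduced_step : reduction_step G reduced.
Proof.
have [_ _ m1 m2] := mM.
exists u, v, m; split=> //.
- move=> a ua av; have: (a, m a) \in ms by rewrite matching_fun m1 ua av eqxx.
  by case/matching_mem.
- move=> a b ua av ub bv E; apply: (@matching_inj _ _ (m a)).
    by rewrite matching_fun m1 ua av eqxx.
  by rewrite matching_fun m1 ub bv E eqxx.
- move=> b vb bu; have: b \in unzip2 ms by rewrite m2 vb bu.
  case/mapP => -[a b'] h /= ->; have [ua av _ _] := matching_mem h.
  by exists a; split=> //; move: h; rewrite matching_fun => /andP[_ /eqP].
- exists val; split=> //; first exact: val_inj.
    by move=> x; have /andP[] := valP x.
  move=> y yu yv; have h : (y != u) && (y != v) by rewrite yu.
  by exists (Sub y h).
Qed.

Lemma matching_col (a b : G) : (a, b) \in ms -> ~~ ccol a /\ ccol b.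
Proof.
case/matching_mem => ua _ vb _.
by rewrite (v3_adj_col vG ua) (v3_adj_col vG vb) cu (negbTE cv).
Qed.

(** This is the degenerate case [x = b], [y = a] of the first clause of [admissible], the walk
    [a b a b]. *)
Lemma matching_nadj (a b : G) : (a, b) \in ms -> ~~ cadj a b.
Proof.
move=> h; apply/negP => ab; have [_ av _ bu] := matching_mem h.
by have := adm.1 _ _ b a h ab bu; rewrite (v3_adjC vG) ab => /(_ isT av).
Qed.

(** A matched vertex loses exactly one neighbour, since no vertex is adjacent to both the black [u]
    and the white [v], and it gains its partner, which is new by [matching_nadj]. The neighbourhood
    of any other vertex is unchanged. *)
Lemma reduced_degree (x : G) : x != u -> x != v ->
  #|[set y | [&& y != u, y != v & [|| cadj x y, (x, y) \in ms | (y, x) \in ms]]]| = 3.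
Proof.
move=> xu xv; have [_ _ m1 m2] := mM.
have xuF : cadj x u -> cadj x v = false.
  move=> xu'; apply: contraNF cv => xv'.
  by rewrite (v3_adj_col vG xv') -(v3_adj_col vG xu').
case x1: (x \in unzip1 ms).
  have [b h] : exists b, (x, b) \in ms by exists (m x); rewrite matching_fun x1 eqxx.
  have [ux _ vb bu] := matching_mem h.
  have [cx cb] := matching_col h.
  have bv : b != v by apply: contraNneq cv => <-.
  rewrite (_ : [set _ | _] = b |: ([set y | cadj x y] :\ u)).
    rewrite cardsU1 !inE bu (negbTE (matching_nadj h)) add1n; congr _.+1.
    have := cardsD1 u [set y | cadj x y]; rewrite (v3_card_nbrs vG) inE (v3_adjC vG) ux.
    by case.
  apply/setP => y; rewrite !inE.
  have -> : ((x, y) \in ms) = (y == b).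
    by apply/idP/eqP => [h'|-> //]; exact: (matching_funct h' h).
  have -> : ((y, x) \in ms) = false.
    by apply/negP => /matching_col[_]; rewrite (negbTE cx).
  rewrite orbF; case: (eqVneq y b) => [->|yb]; first by rewrite bu bv orbT.
  rewrite orbF; case: (eqVneq y u) => //= yu; case: (eqVneq y v) => //= yv.
  by rewrite yv xuF // (v3_adjC vG).
case x2: (x \in unzip2 ms).
  have [a h] : exists a, (a, x) \in ms.
    by case/mapP: x2 => -[a b] h /= ->; exists a.
  have [ua av vx _] := matching_mem h.
  have [ca cx] := matching_col h.
  have au : a != u by apply: contraNneq ca => ->.
  rewrite (_ : [set _ | _] = a |: ([set y | cadj x y] :\ v)).
    rewrite cardsU1 !inE av (v3_adjC vG) (negbTE (matching_nadj h)) add1n; congr _.+1.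
    have := cardsD1 v [set y | cadj x y]; rewrite (v3_card_nbrs vG) inE (v3_adjC vG) vx.
    by case.
  apply/setP => y; rewrite !inE.
  have -> : ((y, x) \in ms) = (y == a).
    by apply/idP/eqP => [h'|-> //]; exact: (matching_inj h' h).
  have -> : ((x, y) \in ms) = false.
    by apply/negP => /matching_col[]; rewrite cx.
  rewrite /=; case: (eqVneq y a) => [->|ya]; first by rewrite au av orbT.
  rewrite orbF; case: (eqVneq y u) => //= ->.
  by symmetry; apply/negP => /andP[_ /xuF]; rewrite (v3_adjC vG) vx.
rewrite -(v3_card_nbrs vG x); congr #|pred_of_set _|; apply/setP => y; rewrite !inE.
have -> : ((x, y) \in ms) = false.
  by apply/negP => h; move/negP: x1; apply; apply/mapP; exists (x, y).
have -> : ((y, x) \in ms) = false.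
  by apply/negP => h; move/negP: x2; apply; apply/mapP; exists (y, x).
rewrite !orbF; apply/and3P/idP => [[] //|xy]; split=> //.
  by apply: contraTneq xy => ->; rewrite (v3_adjC vG); move: x1; rewrite m1 xv andbT => ->.
by apply: contraTneq xy => ->; rewrite (v3_adjC vG); move: x2; rewrite m2 xu andbT => ->.
Qed.

(** Split by which of the four edges are new. Two new edges at a common vertex contradict the
    matching, two opposite ones the second clause of [admissible], a single one its first clause,
    and none the girth of [G]. *)
Lemma reduced_no_square (w1 b1 w2 b2 : G) :
  all (fun x => (x != u) && (x != v)) [:: w1; b1; w2; b2] ->
  w1 != w2 -> b1 != b2 ->
  cadj w1 b1 || ((w1, b1) \in ms) -> cadj w2 b1 || ((w2, b1) \in ms) ->
  cadj w2 b2 || ((w2, b2) \in ms) -> cadj w1 b2 || ((w1, b2) \in ms) -> False.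
Proof.
have [H1 H2] := adm; have sym := v3_adjC vG.
move=> /and5P[/andP[uw1 vw1] /andP[ub1 vb1] /andP[uw2 vw2] /andP[ub2 vb2] _] w12 b12.
have P x y a b (h : (a, b) \in ms) : cadj a x -> x != u -> cadj b y -> y != v -> cadj x y -> False.
  by move=> ax ux bY vy; apply/negP/(H1 _ _ _ _ h).
have F x y y' : (x, y) \in ms -> (x, y') \in ms -> y != y' -> False.
  by move=> h /(matching_funct h) ->; rewrite eqxx.
have I x x' y : (x, y) \in ms -> (x', y) \in ms -> x != x' -> False.
  by move=> h /(matching_inj h) ->; rewrite eqxx.
case/orP=> e1; case/orP=> e2; case/orP=> e3; case/orP=> e4;
 try solve [ exact: F e1 e4 _ | exact: F e2 e3 _ | exact: I e1 e2 _ | exact: I e4 e3 _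
 | exact: H2 e1 e3 _ e4 e2 | exact: H2 e4 e2 _ e1 e3].
- by move/eqP: b12; apply; apply: (v3_no_square vG w12).
- by apply: (P b1 w2 _ _ e4) => //; rewrite sym.
- by apply: (P b1 w1 _ _ e3) => //; rewrite sym.
- by apply: (P b2 w1 _ _ e2) => //; rewrite sym.
- by apply: (P b2 w2 _ _ e1) => //; rewrite sym.
Qed.

Lemma reduced_v3 : v3 reduced.
Proof.
apply: v3_intro.
- split=> [x y|x]; first by rewrite !reduced_adj (v3_adjC vG); congr (_ || _); exact: orbC.
  rewrite reduced_adj !negb_or andbb; apply/andP; split.
    by apply/negP => /(v3_adj_neq vG); rewrite eqxx.
  by apply/negP => /matching_col[] /negbTE ->.
- move=> x y; rewrite reduced_adj /= => /or3P[/(v3_adj_col vG)->|/matching_col[]|/matching_col[]].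
  + by case: (ccol _).
  + by move=> /negbTE -> ->.
  + by move=> /negbTE -> ->.
- move=> x; have /andP[xu xv] := valP x.
  rewrite -(reduced_degree xu xv) -(card_imset _ val_inj); congr #|pred_of_set _|.
  apply/setP => y; apply/imsetP/idP => [[y' h ->]|].
    rewrite inE reduced_adj in h.
    by rewrite inE h; have /andP[-> ->] := valP y'.
  rewrite inE => /and3P[yu yv h]; have hy : (y != u) && (y != v) by rewrite yu.
  by exists (Sub y hy) => //; rewrite inE reduced_adj.
- move=> x y a b xy ab; rewrite !reduced_adj.
  have /andP[] := valP x; have /andP[] := valP y; have /andP[] := valP a; have /andP[] := valP b.
  rewrite -!(inj_eq val_inj) in xy ab.
  have K (s t : G) : ccol t ->
      [|| cadj s t, (s, t) \in ms | (t, s) \in ms] -> cadj s t || ((s, t) \in ms).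
    by move=> ct /or3P[->|->|/matching_col[]]; rewrite ?orbT ?ct.
  move: (val x) (val y) (val a) (val b) xy ab => {}x {}y {}a {}b xy ab.
  move=> bu bv au av yu yv xu xv.
  have C (s t : G) : [|| cadj s t, (s, t) \in ms | (t, s) \in ms] -> ccol t = ~~ ccol s.
    by case/or3P=> [/(v3_adj_col vG)|/matching_col[]|/matching_col[]] // /negbTE -> ->.
  have Sy (s t : G) :
      [|| cadj s t, (s, t) \in ms | (t, s) \in ms] = [|| cadj t s, (t, s) \in ms | (s, t) \in ms].
    by rewrite (v3_adjC vG); congr (_ || _); exact: orbC.
  move=> xa ay yb bx; have [ca cy cb] := And3 (C _ _ xa) (C _ _ ay) (C _ _ yb).
  (* Pairs of [ms] go from white to black, so the square is read from its white vertex [a] when [x]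
     is black. *)
  case cx: (ccol x) ca cy cb => /= ca cy cb; rewrite ca /= in cy; rewrite cy /= in cb.
    apply: (@reduced_no_square a x b y) => //=; first by rewrite au av xu xv bu bv yu yv.
    1-4: by apply: K => //; rewrite // Sy.
  apply: (@reduced_no_square x a y b) => //=; first by rewrite au av xu xv bu bv yu yv.
  all: by apply: K => //; rewrite // Sy.
Qed.

(** Connectedness becomes a condition on vertex sets of [G], ready for cut arguments: the set to
    test is the component of a vertex of [reduced], viewed in [G]. *)
Lemma reduced_connected :
  (forall S : {set G}, u \notin S -> v \notin S -> S != set0 ->
     (forall x y, x \in S -> cadj x y -> y != u -> y != v -> y \in S) ->
     (forall a b, (a, b) \in ms -> (a \in S) = (b \in S)) ->
     forall y, y != u -> y != v -> y \in S) ->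
  gconnected reduced.
Proof.
move=> crit; split.
  have [|y uy] := @v3_new_nbr _ vG u [:: v]; first by [].
  rewrite inE => yv; have hy : (y != u) && (y != v) by rewrite yv eq_sym (v3_adj_neq vG uy).
  by apply/card_gt0P; exists (Sub y hy).
move=> x y; have /andP[yu yv] := valP y.
pose S := val @: [set z | connect (@cadj reduced) x z].
have inS (z : reduced) : (val z \in S) = connect (@cadj reduced) x z.
  by rewrite mem_imset ?inE //; apply: val_inj.
have SP z : z \in S -> exists2 z' : reduced, z = val z' & connect (@cadj reduced) x z'.
  by case/imsetP => z'; rewrite inE => h ->; exists z'.
rewrite -inS; apply: (crit S) => //.
- by apply/negP => /SP[z E _]; have := valP z; rewrite -E eqxx.
- by apply/negP => /SP[z E _]; have := valP z; rewrite -E eqxx andbF.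
- by apply/set0Pn; exists (val x); rewrite inS connect0.
- move=> _ t /SP[s -> xs] st tu tv; have ht : (t != u) && (t != v) by rewrite tu.
  rewrite -[t]/(val (Sub t ht : reduced)) inS; apply: connect_trans xs (connect1 _).
  by rewrite reduced_adj /= st.
- move=> a b h; have [ua av vb bu] := matching_mem h; have [ca cb] := matching_col h.
  have ha : (a != u) && (a != v) by rewrite av andbT; apply: contraNneq ca => ->.
  have hb : (b != u) && (b != v) by rewrite bu; apply: contraTneq cb => ->.
  rewrite -[a]/(val (Sub a ha : reduced)) -[b]/(val (Sub b hb : reduced)) !inS.
  apply/idP/idP => /connect_trans; apply; apply: connect1; rewrite reduced_adj /= h ?orbT //.
Qed.

End Reduce.

(** * Irreducible graphs are 3-edge-connected *)

Section Irreducible.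
Variable G : cgraph.
Hypotheses (vG : v3 G) (conG : gconnected G) (irrG : irreducible G).

Lemma connected_closed (S : {set G}) (s y : G) :
  s \in S -> (forall x y, x \in S -> cadj x y -> y \in S) -> y \in S.
Proof.
move=> sS closed; have /connectP[p] := conG.2 s y.
elim: p s sS => [|z p IH] s sS /=; first by move=> _ ->.
by case/andP => /(closed _ _ sS) zS; apply: IH.
Qed.

(* Counting the edges at the black and at the white vertices of [S] modulo 3. *)
Lemma no_bridge (S : {set G}) (s t : G) : s \in S -> t \notin S -> cadj s t ->
  (forall x y, x \in S -> y \notin S -> cadj x y -> x = s /\ y = t) -> False.
Proof.
move=> sS tS st bridge.
pose e c := \sum_(x in S | ccol x == c) \sum_(y in S | ccol y == ~~ c) (cadj x y : nat).
have degree (x : G) : \sum_y (cadj x y : nat) = 3.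
  by rewrite -(v3_card_nbrs vG x) -sum1dep_card [RHS]big_mkcond; apply: eq_bigr => y _; case: cadj.
have count c : 3 * #|[set x in S | ccol x == c]| = e c + (ccol s == c).
  have -> : 3 * #|[set x in S | ccol x == c]| =
      \sum_(x in S | ccol x == c) \sum_y (cadj x y : nat).
    rewrite (eq_bigr (fun=> 3)) => [|x _]; last exact: degree.
    by rewrite big_const iter_addn addn0 mulnC cardsE mulnC.
  have -> : (ccol s == c : nat) =
      \sum_(x in S | ccol x == c) \sum_(y | y \notin S) (cadj x y : nat).
    case: (boolP (ccol s == c)) => cs.
      rewrite (bigD1 s) /=; last by rewrite sS.
      rewrite (bigD1 t) //= st !big1 // => [x|y].
        case/andP => /andP[xS _] xs; rewrite big1 // => y yS.
        by case: (boolP (cadj x y)) => // /(bridge _ _ xS yS)[E]; rewrite E eqxx in xs.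
      case/andP => yS yt; case: (boolP (cadj s y)) => // /(bridge _ _ sS yS)[_ E].
      by rewrite E eqxx in yt.
    rewrite big1 // => x /andP[xS cx]; rewrite big1 // => y yS.
    by case: (boolP (cadj x y)) => // /(bridge _ _ xS yS)[E]; rewrite -E cx in cs.
  rewrite -big_split; apply: eq_bigr => x /andP[xS /eqP cx] /=.
  rewrite (bigID (mem S)) /=; congr (_ + _).
  rewrite [RHS]big_mkcondr; apply: eq_bigr => y _.
  by case: (boolP (cadj x y)) => [/(v3_adj_col vG)->|_]; rewrite ?cx ?eqxx ?if_same.
have eC : e true = e false.
  rewrite /e exchange_big; apply: eq_bigr => x _; apply: eq_bigr => y _.
  by rewrite (v3_adjC vG).
(* Both [e true + (ccol s == true)] and [e false + (ccol s == false)] are multiples of 3, yet they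
   differ by exactly one. *)
have := congr1 (modn^~ 3) (count true); have := congr1 (modn^~ 3) (count false).
rewrite /= !modnMr -eC; case: (ccol s); rewrite /= ?addn0 => /esym h.
  by rewrite -modnDml h.
by move/esym; move: h; rewrite -modnDml => + h; rewrite h.
Qed.

Definition spanning (u v : G) (ms : seq (G * G)) : Prop :=
  forall S : {set G}, u \notin S -> v \notin S -> S != set0 ->
     (forall x y, x \in S -> cadj x y -> y != u -> y != v -> y \in S) ->
     (forall a b, (a, b) \in ms -> (a \in S) = (b \in S)) ->
     forall y, y != u -> y != v -> y \in S.

(** Since [reduction_step] wants [u] black, the other case is reached by exchanging [u] and [v] and
    reversing the pairs. From here on only the opposite colours of [u] and [v] matter. *)
Lemma reduction_contra (u v : G) ms : ccol v = ~~ ccol u ->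
  is_matching u v ms -> admissible u v ms -> spanning u v ms -> False.
Proof.
wlog cu : u v ms / ccol u.
  move=> W cv mM [H1 H2] sp; case cu: (ccol u); first exact: (W u v ms).
  apply: (W v u [seq (p.2, p.1) | p <- ms]); rewrite ?cv ?cu //.
  - exact: matching_swap.
  - split=> [b a y x|b a b' a']; rewrite !mem_swap.
      by move=> h bY yv ax xu; rewrite (v3_adjC vG); apply: H1 h ax xu bY yv.
    move=> h h' bb' ba' b'a; apply: (H2 a b a' b') => //; rewrite 1?(v3_adjC vG) //.
    apply: contraNneq bb' => E; rewrite E in h.
    by rewrite (matching_funct mM h h').
  - move=> S vS uS S0 cl cm y yv yu; apply: (sp S) => // [x z xS xz zu zv|a b h].
      exact: cl xS xz zv zu.
    by apply/esym/cm; rewrite mem_swap.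
move=> cv; rewrite cu in cv => mM adm sp.
have cv' : ~~ ccol v by rewrite cv.
exact: (irrG (reduced_step cu cv' mM)
  (reduced_v3 vG cu cv' mM adm) (reduced_connected vG cu cv' mM sp)).
Qed.

(** The opposite colours of [u] and [v] force [u != v] and [a != b], so the two cut edges are
    disjoint. *)
Definition edge_cut2 (S : {set G}) (u v a b : G) : Prop :=
  [/\ u \notin S, v \notin S, a \in S, b \in S &
  [/\ cadj u a, cadj v b, ccol v = ~~ ccol u &
      forall x y, x \in S -> y \notin S -> cadj x y ->
        (x = a /\ y = u) \/ (x = b /\ y = v)]].

(** An edge from [S] to [u] or [v] starts at a matched vertex. If [S] contained none, it would be
    closed under adjacency in the connected graph [G] and so contain [u]. *)
Lemma closed_meets_matching (u v : G) (S : {set G}) ms : is_matching u v ms ->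
  u \notin S -> v \notin S -> S != set0 ->
  (forall x y, x \in S -> cadj x y -> y != u -> y != v -> y \in S) ->
  (forall a b, (a, b) \in ms -> (a \notin S) && (b \notin S)) -> False.
Proof.
move=> [_ _ m1 m2] uS vS /set0Pn[s sS] cl mS.
move/negP: (uS); apply.
apply: (connected_closed (s := s)) => // x y xS xy.
have [yu|yu] := eqVneq y u.
  have: x \in unzip1 ms.
    by rewrite m1 -yu (v3_adjC vG) xy /=; apply: contraNneq vS => <-.
  by case/mapP => -[a b] /mS/andP[/negP aS _] /= E; rewrite E in xS.
have [yv|yv] := eqVneq y v; last exact: cl xS xy yu yv.
have: x \in unzip2 ms.
  by rewrite m2 -yv (v3_adjC vG) xy /=; apply: contraNneq uS => <-.
by case/mapP => -[a b] /mS/andP[_ /negP bS] /= E; rewrite E in xS.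
Qed.

Lemma closed_compl (u v : G) (S : {set G}) :
  (forall x y, x \in S -> cadj x y -> y != u -> y != v -> y \in S) ->
  let T := [set x | [&& x \notin S, x != u & x != v]] in
  forall x y, x \in T -> cadj x y -> y != u -> y != v -> y \in T.
Proof.
move=> cl T x y; rewrite !inE => /and3P[xS xu xv] xy -> ->; rewrite !andbT.
by apply: contra xS => yS; apply: cl yS _ xu xv; rewrite (v3_adjC vG).
Qed.

(** Neither side of a splitting can miss both pairs, by [closed_meets_matching], so the two pairs
    lie on different sides. Passing to the complement puts the first pair into [S]. *)
Lemma spanning2 (u v a1 b1 a2 b2 : G) :
  is_matching u v [:: (a1, b1); (a2, b2)] ->
  (forall S : {set G}, u \notin S -> v \notin S ->
     (forall x y, x \in S -> cadj x y -> y != u -> y != v -> y \in S) ->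
     a1 \in S -> b1 \in S -> a2 \notin S -> b2 \notin S -> False) ->
  spanning u v [:: (a1, b1); (a2, b2)].
Proof.
move=> mM H S uS vS S0 cl cm y yu yv; apply/negPn/negP => yS.
have E1 : (a1 \in S) = (b1 \in S) by apply: cm; rewrite inE eqxx.
have E2 : (a2 \in S) = (b2 \in S) by apply: cm; rewrite !inE eqxx orbT.
pose T := [set x | [&& x \notin S, x != u & x != v]].
have clT := closed_compl cl; rewrite -/T in clT.
have [uT vT] : u \notin T /\ v \notin T by rewrite !inE !eqxx !andbF.
have T0 : T != set0 by apply/set0Pn; exists y; rewrite inE yS yu.
have inT a b : (a, b) \in [:: (a1, b1); (a2, b2)] ->
    (a \in T) = (a \notin S) /\ (b \in T) = (b \notin S).
  case/(matching_mem mM) => ua av vb bu; rewrite !inE av bu.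
  have [-> ->] : a != u /\ b != v by split; rewrite eq_sym; apply: (v3_adj_neq vG).
  by rewrite !andbT.
have [A1 B1] := inT a1 b1 (mem_head _ _).
have [A2 B2] : (a2 \in T) = (a2 \notin S) /\ (b2 \in T) = (b2 \notin S).
  by apply: inT; rewrite !inE eqxx orbT.
case a1S: (a1 \in S) E1 A1 => /esym E1 A1; rewrite E1 /= in B1;
case a2S: (a2 \in S) E2 A2 => /esym E2 A2; rewrite E2 /= in B2.
- apply: (closed_meets_matching mM uT vT T0 clT) => a b.
  rewrite in_cons => /orP[/eqP[-> ->]|]; first by rewrite A1 B1.
  by rewrite mem_seq1 => /eqP[-> ->]; rewrite A2 B2.
- by apply: (H S); rewrite ?a1S ?a2S ?E1 ?E2.
- by apply: (H T); rewrite ?A1 ?A2 ?B1 ?B2.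
- apply: (closed_meets_matching mM uS vS S0 cl) => a b.
  rewrite in_cons => /orP[/eqP[-> ->]|]; first by rewrite a1S E1.
  by rewrite mem_seq1 => /eqP[-> ->]; rewrite a2S E2.
Qed.

(* If [a] and [b] are adjacent, reduce by them, joining the two sides of the cut
   by both new edges. *)
Lemma no_edge_cut2_adj S u v a b : edge_cut2 S u v a b -> ~~ cadj a b.
Proof.
case=> uS vS aS bS [ua vb cvu cut]; apply/negP => ab.
have sym := v3_adjC vG.
have ca := v3_adj_col vG ua; have cb := v3_adj_col vG vb.
have uv : u != v by apply: contra_eqN cvu => /eqP->; case: (ccol v).
have aNb := v3_adj_neq vG ab.
have [p ap] := @v3_new_nbr _ vG a [:: b; u] isT; rewrite !inE negb_or => /andP[pb pu].
have [q bq] := @v3_new_nbr _ vG b [:: a; v] isT; rewrite !inE negb_or => /andP[qa qv].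
have bu : b != u by apply: contraNneq uS => <-.
have av : a != v by apply: contraNneq vS => <-.
have Na y : cadj a y = (y \in [:: b; u; p]).
  apply: (v3_adj_mem vG) => //=; last by rewrite ab sym ua ap.
  by rewrite !inE !negb_or bu eq_sym pb eq_sym pu.
have Nb y : cadj b y = (y \in [:: a; v; q]).
  apply: (v3_adj_mem vG) => //=; last by rewrite sym ab sym vb bq.
  by rewrite !inE !negb_or av eq_sym qa eq_sym qv.
have [cp cq] := (v3_adj_col vG ap, v3_adj_col vG bq).
have pS : p \in S.
  by apply/negPn/negP => pS; have [[_ E]|[E _]] := cut _ _ aS pS ap;
    [rewrite E eqxx in pu | rewrite E eqxx in aNb].
have qS : q \in S.
  by apply/negPn/negP => qS; have [[E _]|[_ E]] := cut _ _ bS qS bq;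
    [rewrite E eqxx in aNb | rewrite E eqxx in qv].
(* The other neighbours of [b] are [v] and [q], those of [a] are [p] and [u]; with [p] and [q] in
   [S], both new edges [vp] and [qu] cross the cut. *)
have mM : is_matching b a [:: (v, p); (q, u)].
  split=> /=.
  - by rewrite inE eq_sym qv.
  - by rewrite inE pu.
  - move=> y; rewrite Nb !inE; case: (eqVneq y a) => [->|] /=; last by rewrite andbT.
    by rewrite (negbTE av) eq_sym (negbTE qa).
  - move=> y; rewrite Na !inE; case: (eqVneq y b) => [->|] /=.
      by rewrite eq_sym (negbTE pb) (negbTE bu).
    by rewrite andbT orbC.
apply: (@reduction_contra b a [:: (v, p); (q, u)]) => //.
- by rewrite ca cb cvu negbK.
- split.
    (* On a path [v x y p] or [q x y u] the middle edge would cross the cut, and neither [ua] nor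
       [vb] fits: one end would be a deleted vertex, a loop would arise, or the colours would
       clash. *)
    move=> s t x y; rewrite !inE => /orP[] /eqP[-> ->].
      move=> vx xb py ya; apply/negP => xy.
      have xS : x \notin S.
        apply/negP => xS; have := cut _ _ xS vS; rewrite sym => /(_ vx) [[_ E]|[E _]].
          by rewrite E eqxx in uv.
        by rewrite E eqxx in xb.
      have yS : y \in S.
        apply/negPn/negP => yS; have [[E _]|[E _]] := cut _ _ pS yS py.
          by have := v3_adj_neq vG ap; rewrite E eqxx.
        by rewrite E eqxx in pb.
      have := cut _ _ yS xS; rewrite sym => /(_ xy) [[E _]|[E _]]; first by rewrite E eqxx in ya.
      by have := v3_adj_col vG py; rewrite E cb cp ca cvu; case: (ccol u).
    move=> qx xb uy ya; apply/negP => xy.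
    have xS : x \in S.
      apply/negPn/negP => xS; have [[E _]|[E _]] := cut _ _ qS xS qx.
        by rewrite E eqxx in qa.
      by have := v3_adj_neq vG bq; rewrite E eqxx.
    have yS : y \notin S.
      apply/negP => yS; have := cut _ _ yS uS; rewrite sym => /(_ uy) [[E _]|[_ E]].
        by rewrite E eqxx in ya.
      by rewrite E eqxx in uv.
    have [[_ E]|[E _]] := cut _ _ xS yS xy; last by rewrite E eqxx in xb.
    by have := v3_adj_neq vG uy; rewrite E eqxx.
  (* The second kind of obstruction would need [v] adjacent to [u], which closes the square
     [u a b v]. *)
  have sq : cadj v u -> False.
    move=> vu; have := @v3_no_square _ vG u b v a; rewrite eq_sym bu [cadj u v]sym vu.
    rewrite [cadj b v]sym vb ua [cadj b a]sym ab => /(_ isT isT isT isT isT) E.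
    by rewrite E eqxx in av.
  move=> s t s' t'; rewrite !inE => /orP[] /eqP[-> ->] /orP[] /eqP[-> ->] //; rewrite ?eqxx //.
- apply: spanning2 => // T bT aT cl vT pT qT uT.
  (* An edge leaving [T :\: S] either enters [S], and is then [vb] because [u] is not in [T], or
     leaves [T] outside [S], which closedness of [T] forbids. So [vb] would be a bridge. *)
  apply: (@no_bridge (T :\: S) v b); rewrite ?inE ?vS ?vT ?bS // => x y.
  rewrite !inE negb_and negbK => /andP[xS xT] /orP[yS|yT] xy.
    have := cut _ _ yS xS; rewrite sym => /(_ xy) [[_ E]|[-> ->]] //.
    by rewrite -E xT in uT.
  case yS: (y \in S).
    have := cut _ _ yS xS; rewrite sym => /(_ xy) [[_ E]|[-> ->]] //.
    by rewrite -E xT in uT.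
  exfalso; move/negP: yT; apply; apply: cl xT xy _ _; apply: contraFneq yS => -> //.
Qed.

Lemma edge_cut2C S u v a b : edge_cut2 S u v a b -> edge_cut2 (~: S) a b u v.
Proof.
case=> uS vS aS bS [ua vb cvu cut]; split; rewrite ?inE ?negbK //; split.
- by rewrite (v3_adjC vG).
- by rewrite (v3_adjC vG).
- by rewrite (v3_adj_col vG ua) (v3_adj_col vG vb) cvu.
move=> x y; rewrite !inE negbK => xS yS; rewrite (v3_adjC vG) => xy.
by case: (cut _ _ yS xS xy) => -[-> ->]; [left | right].
Qed.

(** By the previous lemma, applied to both sides of the cut, [a], [b] and [u], [v] are non-adjacent
    pairs, so the reduction is by the ends of [ua]. The remaining neighbours of [u] lie outside [S]
    and differ from [v], those of [a] lie inside and differ from [b]; hence no old edge joins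
    them. *)
Lemma no_edge_cut2 S u v a b : edge_cut2 S u v a b -> False.
Proof.
move=> C2; have nab := no_edge_cut2_adj C2.
have nuv := no_edge_cut2_adj (edge_cut2C C2).
case: C2 => uS vS aS bS [ua vb cvu cut].
have sym := v3_adjC vG.
have ca := v3_adj_col vG ua; have cb := v3_adj_col vG vb.
have uNv : u != v by apply: contra_eqN cvu => /eqP->; case: (ccol v).
have aNb : a != b.
  by apply: contra_eqN cvu => /eqP E; rewrite -E ca in cb; move: cb; do 2!case: (ccol _).
have [x1 ux1] := @v3_new_nbr _ vG u [:: a] isT; rewrite !inE => x1a.
have [x2 ux2] := @v3_new_nbr _ vG u [:: a; x1] isT; rewrite !inE negb_or => /andP[x2a x21].
have [y1 ay1] := @v3_new_nbr _ vG a [:: u] isT; rewrite !inE => y1u.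
have [y2 ay2] := @v3_new_nbr _ vG a [:: u; y1] isT; rewrite !inE negb_or => /andP[y2u y21].
have Nu y : cadj u y = (y \in [:: a; x1; x2]).
  apply: (v3_adj_mem vG) => //=; last by rewrite ua ux1 ux2.
  by rewrite !inE !negb_or ![a == _]eq_sym x1a x2a eq_sym x21.
have Na y : cadj a y = (y \in [:: u; y1; y2]).
  apply: (v3_adj_mem vG) => //=; last by rewrite sym ua ay1 ay2.
  by rewrite !inE !negb_or ![u == _]eq_sym y1u y2u eq_sym y21.
have mM : is_matching u a [:: (x1, y1); (x2, y2)].
  split=> /=.
  - by rewrite inE eq_sym x21.
  - by rewrite inE eq_sym y21.
  - move=> y; rewrite Nu !inE; case: (eqVneq y a) => [->|] /=; last by rewrite andbT.
    by rewrite ![a == _]eq_sym (negbTE x1a) (negbTE x2a).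
  - move=> y; rewrite Na !inE; case: (eqVneq y u) => [->|] /=; last by rewrite andbT.
    by rewrite ![u == _]eq_sym (negbTE y1u) (negbTE y2u).
have outx x : cadj u x -> x != a -> x \notin S /\ x != v.
  move=> ux xa; split; last by apply: contraNneq nuv => <-.
  apply/negP => xS; have := cut _ _ xS uS; rewrite sym => /(_ ux) [[E _]|[_ E]].
    by rewrite E eqxx in xa.
  by rewrite E eqxx in uNv.
have iny y : cadj a y -> y != u -> y \in S /\ y != b.
  move=> ay yu; split; last by apply: contraNneq nab => <-.
  apply/negPn/negP => yS; have [[_ E]|[E _]] := cut _ _ aS yS ay.
    by rewrite E eqxx in yu.
  by rewrite E eqxx in aNb.
have nxy x y : cadj u x -> x != a -> cadj a y -> y != u -> ~~ cadj x y.
  move=> ux xa ay yu; have [xS xv] := outx x ux xa; have [yS yb] := iny y ay yu.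
  apply/negP; rewrite sym => yx; have [[E _]|[E _]] := cut _ _ yS xS yx.
    by have := v3_adj_neq vG ay; rewrite E eqxx.
  by rewrite E eqxx in yb.
apply: (@reduction_contra u a [:: (x1, y1); (x2, y2)]) => //.
(* On a path [x s t y] the edge [s t] crosses the cut. It is not [ua], as [t != a], and for [vb] the
   adjacent vertices [y] and [b] would have the same colour. *)
- split=> [x y s t h xs su yt ta|x y x' y' h h' xx' xy' _]; last first.
    have [ux xa _ _] := matching_mem mM h; have [_ _ ay yu] := matching_mem mM h'.
    by move/negP: (nxy x y' ux xa ay yu).
  have [ux xa ay yu] := matching_mem mM h.
  have [xS xv] := outx x ux xa; have [yS yb] := iny y ay yu.
  have sS : s \notin S.
    apply/negP => sS; have := cut _ _ sS xS; rewrite sym => /(_ xs) [[_ E]|[_ E]].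
      by have := v3_adj_neq vG ux; rewrite E eqxx.
    by rewrite E eqxx in xv.
  have tS : t \in S.
    apply/negPn/negP => tS; have [[E _]|[E _]] := cut _ _ yS tS yt.
      by have := v3_adj_neq vG ay; rewrite E eqxx.
    by rewrite E eqxx in yb.
  apply/negP; rewrite sym => ts; have [[E _]|[E _]] := cut _ _ tS sS ts.
    by rewrite E eqxx in ta.
  have := v3_adj_col vG yt; rewrite E (v3_adj_col vG ay) ca cb cvu.
  by case: (ccol u).
- apply: spanning2 => // T uT aT cl x1T y1T x2T y2T.
  have [y1S y1b] := iny y1 ay1 y1u; have [y2S y2b] := iny y2 ay2 y2u.
  (* [T] splits [S] without [a] into a part with [y1] and a part with [y2]. The part that misses [b]
     is joined to the rest only by its edge to [a], a bridge. *)
  case bT: (b \in T).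
    apply: (@no_bridge (S :\: T :\ a) y2 a);
      rewrite ?inE ?y2S ?y2T ?eqxx // 1?sym // 1?[y2 == a]eq_sym ?(v3_adj_neq vG ay2) // => x y.
    rewrite !inE => /and3P[xa xT xS] nyT xy.
    have [yS|yS] := boolP (y \in S); last first.
      have [[E _]|[E _]] := cut _ _ xS yS xy; first by rewrite E eqxx in xa.
      by rewrite E bT in xT.
    have [ya|ya] := eqVneq y a.
      split=> //; move: xy; rewrite ya sym Na !inE => /or3P[] /eqP // E.
        by move: xS; rewrite E (negbTE uS).
      by rewrite E y1T in xT.
    move: nyT; rewrite ya yS andbT /= negbK => yT; move/negP: xT; case.
    apply: cl yT _ _ xa; first by rewrite sym.
    by apply: contraNneq uS => <-.
  apply: (@no_bridge (T :&: S) y1 a); rewrite ?inE ?y1T ?y1S ?(negbTE aT) // 1?sym // => x y.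
  rewrite !inE => /andP[xT xS]; rewrite negb_and => nyT xy.
  have [yS|yS] := boolP (y \in S); last first.
    have [[E _]|[E _]] := cut _ _ xS yS xy; first by rewrite -E xT in aT.
    by rewrite -E xT in bT.
  move: nyT; rewrite yS orbF => nyT.
  have [ya|ya] := eqVneq y a.
    split=> //; move: xy; rewrite ya sym Na !inE => /or3P[] /eqP // E.
      by move: xS; rewrite E (negbTE uS).
    by rewrite -E xT in y2T.
  by exfalso; move/negP: nyT; apply; apply: cl xT xy _ ya; apply: contraNneq uS => <-.
Qed.

Lemma matching_size (u v : G) ms : is_matching u v ms -> size ms <= 3.
Proof.
case=> u1 _ m1 _; rewrite -(size_map fst) -(card_uniqP u1) -(v3_card_nbrs vG u).
by apply/subset_leq_card/subsetP => a; rewrite m1 inE => /andP[].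
Qed.

(** Connectedness is automatic here: if the reduced graph split, one of the two sides would hold at
    most one of the at most three matched pairs. *)
Lemma irreducible_not_admissible (u v : G) ms : ccol v = ~~ ccol u ->
  is_matching u v ms -> ~ admissible u v ms.
Proof.
move=> cvu mM adm; apply: (reduction_contra cvu mM adm) => S uS vS S0 cl cm y yu yv.
apply/negPn/negP => yS.
have [_ _ m1 m2] := mM; have sym := v3_adjC vG.
(* A side without matched pairs contradicts the connectedness of [G]; a side with the single pair
   [(a, b)] is cut off by the edges [ua] and [vb]. *)
have few (T : {set G}) : u \notin T -> v \notin T -> T != set0 ->
    (forall x y, x \in T -> cadj x y -> y != u -> y != v -> y \in T) ->
    (forall a b, (a, b) \in ms -> (a \in T) = (b \in T)) ->
    count (fun p : G * G => p.1 \in T) ms <= 1 -> False.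
  move=> uT vT T0 clT cmT c1.
  have [/hasP[[a b] h /= aT]|/hasPn nT] := boolP (has (fun p : G * G => p.1 \in T) ms); last first.
    by apply: (closed_meets_matching mM uT vT T0 clT) => a b h; rewrite -(cmT _ _ h) andbb (nT _ h).
  have bT : b \in T by rewrite -(cmT _ _ h).
  have [ua _ vb _] := matching_mem mM h.
  have one p : p \in ms -> p.1 \in T -> p = (a, b).
    move=> pm pT; apply/eqP/negPn/negP => pab.
    have: 1 < count (fun p : G * G => p.1 \in T) ms.
      rewrite (permP (perm_to_rem pm)) /= pT -[1]addn0 ltn_add2l -has_count.
      apply/hasP; exists (a, b) => //=.
      have: (a, b) \in p :: rem p ms by rewrite -(perm_mem (perm_to_rem pm)).
      by rewrite inE eq_sym (negbTE pab).
    by rewrite ltnNge c1.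
  apply: (@no_edge_cut2 T u v a b); split=> //; split=> // x z xT zT xz.
  have [zu|zu] := eqVneq z u.
    left; split=> //; have: x \in unzip1 ms.
      by rewrite m1 -zu sym xz /=; apply: contraNneq vT => <-.
    by case/mapP => p pm E; rewrite E in xT *; rewrite (one p pm xT).
  have [zv|zv] := eqVneq z v; last by move/negP: zT; case; apply: clT xT xz zu zv.
  right; split=> //; have: x \in unzip2 ms.
    by rewrite m2 -zv sym xz /=; apply: contraNneq uT => <-.
  case/mapP => -[s t] pm /= E; rewrite E in xT *.
  by rewrite -(cmT _ _ pm) in xT; have [_ ->] := one _ pm xT.
pose T := [set x | [&& x \notin S, x != u & x != v]].
have inT a b : (a, b) \in ms -> (a \in T) = (a \notin S) /\ (b \in T) = (b \notin S).
  case/(matching_mem mM) => ua av vb bu; rewrite !inE av bu.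
  have [-> ->] : a != u /\ b != v by split; rewrite eq_sym; apply: (v3_adj_neq vG).
  by rewrite !andbT.
have cT : count (fun p : G * G => p.1 \in T) ms = count (predC (fun p : G * G => p.1 \in S)) ms.
  by apply: eq_in_count => -[a b] /inT[].
have := matching_size mM; rewrite -(count_predC (fun p : G * G => p.1 \in S)) -cT.
have [h _|h] := leqP (count (fun p : G * G => p.1 \in S) ms) 1; first exact: (few S).
move=> h3; apply: (few T); rewrite ?inE ?eqxx ?andbF //.
- by apply/set0Pn; exists y; rewrite inE yS yu.
- exact: closed_compl.
- by move=> a b hab; have [-> ->] := inT a b hab; rewrite (cm _ _ hab).
- by rewrite -(leq_add2l 2); apply: leq_trans h3; rewrite leq_add2r.
Qed.

End Irreducible.

(** * Search for irreducible graphs *)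

Definition memn (x : nat) (s : seq nat) : bool := has (eqn x) s.

Lemma memn_in x s : memn x s = (x \in s).
Proof. by rewrite -has_pred1; apply: eq_has => y /=; rewrite eq_sym eqnE. Qed.

(* Vertex [i] of a pattern has a colour and a list of its known neighbours;
   it may have further neighbours while there are fewer than three. *)
Definition pattern := seq (bool * seq nat).

Definition order (P : pattern) : nat := size P.
Definition colour (P : pattern) (x : nat) : bool := (nth (false, [::]) P x).1.
Definition nbrs (P : pattern) (x : nat) : seq nat := (nth (false, [::]) P x).2.

(** Three distinct known neighbours are all the neighbours, so the pattern decides every adjacency
    at the image of a full vertex. *)
Definition full (P : pattern) (x : nat) : bool :=
  if nbrs P x is [:: a; b; c] then ~~ [|| eqn a b, eqn a c | eqn b c] else false.

Definition add_nbr (P : pattern) (x y : nat) : pattern :=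
  set_nth (false, [::]) P x (colour P x, y :: nbrs P x).

Definition link (P : pattern) (x y : nat) : pattern := add_nbr (add_nbr P x y) y x.

Definition extend (P : pattern) (x : nat) : pattern :=
  link (rcons P (~~ colour P x, [::])) x (order P).

(** Ends of walks [x a b y]. A backtracking walk, with [b = x] or [y = a], ends in [nbrs P x], which
    the proviso of [blocked] sets aside. *)
Definition third_nbrs (P : pattern) (x : nat) : seq nat :=
  flatten [seq flatten [seq nbrs P b | b <- nbrs P a] | a <- nbrs P x].

(* Given [y \notin nbrs P x], the images of [x] and [y] are known not to be
   adjacent: one of them has its three neighbours already, or the edge would
   close a square. *)
Definition blocked (P : pattern) (x y : nat) : bool :=
  [|| full P x, full P y && ~~ memn x (nbrs P y) | memn y (third_nbrs P x)].

Definition grow (P : pattern) (x : nat) : seq pattern :=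
  rcons [seq link P x y | y <- iota 0 (order P) &
           [&& colour P y (+) colour P x, ~~ memn y (nbrs P x) & ~~ blocked P x y]]
        (extend P x).

Definition without (x : nat) (s : seq nat) : seq nat := [seq y <- s | ~~ eqn x y].

(* The pairs [(x, y)] whose adjacency would join some [(a, b)] of [ms] by a path
   [a x y b] that avoids [u] and [v]. *)
Definition detours (P : pattern) (u v : nat) (ms : seq (nat * nat)) : seq (nat * nat) :=
  flatten [seq [seq (x, y) | x <- without u (nbrs P p.1), y <- without v (nbrs P p.2)]
             | p <- ms].

(* The reduction by [u] and [v] that matches [without v (nbrs P u)] with [bs] in
   this order creates no double edge or square among the known edges. *)
Definition test_ok (P : pattern) (u v : nat) (bs : seq nat) : bool :=
  let us := without v (nbrs P u) in
  let vs := without u (nbrs P v) in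
  let ms := zip us bs in
  [&& full P u && full P v, colour P u (+) colour P v,
      [&& eqn (size us) (size bs), eqn (size vs) (size bs), uniq bs & all (memn^~ vs) bs],
      all (full P) us && all (full P) bs,
      all (fun d => ~~ memn d.2 (nbrs P d.1)) (detours P u v ms) &
      all (fun p => all (fun q => [|| eqn p.1 q.1, ~~ memn q.2 (nbrs P p.1)
                                   | ~~ memn p.2 (nbrs P q.1)]) ms) ms].

(** [test_ok] already rules out the obstruction by two new edges, so a failing reduction leaves only
    detours, one case for each possible middle edge. *)
Definition test (P : pattern) (u v : nat) (bs : seq nat) : seq pattern :=
  [seq link P d.1 d.2
     | d <- detours P u v (zip (without v (nbrs P u)) bs) & ~~ blocked P d.1 d.2].

(** Colours may be exchanged globally: [c] is the discrepancy at vertex 0, and every other vertex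
    must show the same one. *)
Definition subpattern (Q P : pattern) (g : seq nat) : bool :=
  [&& eqn (size g) (order Q), uniq g, all (fun i => i < order P) g,
      all (fun i => all (fun j =>
        (j < order Q) && memn (nth 0 g j) (nbrs P (nth 0 g i))) (nbrs Q i))
          (iota 0 (order Q)) &
      let c := colour Q 0 (+) colour P (nth 0 g 0) in
      all (fun i => ~~ (c (+) (colour Q i (+) colour P (nth 0 g i)))) (iota 0 (order Q))].

(** [lcf_adj] on plain numbers, so that the check can be evaluated without ordinals. *)
Definition lcf_nat (n : nat) (off : nat -> nat) (i j : nat) : bool :=
  [|| (j == (i + 1) %% n :> nat), (i == (j + 1) %% n :> nat),
      (j == (i + off i) %% n :> nat) | (i == (j + off j) %% n :> nat)].

Definition is_lcf (P : pattern) (n : nat) (off : nat -> nat) (g : seq nat) : bool :=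
  [&& eqn (order P) n, eqn (size g) n, uniq g, all (fun i => i < n) g,
      all (full P) (iota 0 n) &
      all (fun i => all (fun j =>
        ~~ (memn (nth 0 g j) (nbrs P (nth 0 g i)) (+) lcf_nat n off i j)) (iota 0 n)) (iota 0 n)].

Definition heawood_off (i : nat) : nat := if odd i then 9 else 5.

(* Instructions of a stack machine that checks a search tree in preorder. [Grow]
   and [Test] replace the pattern on top of the stack by the cases of a new
   neighbour, resp. of a failing reduction. [Keep] marks a pattern which [Store]
   memorises once its cases are settled; [Use k g] closes a pattern that contains
   the [k]-th memorised one through the vertex map [g]. *)
Inductive instr :=
  | Grow of nat
  | Test of nat & nat & seq nat
  | Keep
  | Store
  | Use of nat & seq nat
  | Heawood of seq nat
  | Pappus of seq nat.

Inductive task := Prove of pattern | Remember of pattern.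

Definition step (i : instr) (ts : seq task) (M : seq pattern) :
    option (seq task * seq pattern) :=
  match i, ts with
  | Grow x, Prove P :: ts =>
      if (x < order P) && (size (nbrs P x) < 3) then Some (map Prove (grow P x) ++ ts, M) else None
  | Test u v bs, Prove P :: ts =>
      if test_ok P u v bs then Some (map Prove (test P u v bs) ++ ts, M) else None
  | Keep, Prove P :: ts => Some (Prove P :: Remember P :: ts, M)
  | Store, Remember P :: ts => Some (ts, rcons M P)
  | Use k g, Prove P :: ts =>
      if (k < size M) && subpattern (nth [::] M k) P g then Some (ts, M) else None
  | Heawood g, Prove P :: ts => if is_lcf P 14 heawood_off g then Some (ts, M) else None
  | Pappus g, Prove P :: ts => if is_lcf P 18 pappus_off g then Some (ts, M) else None
  | _, _ => None
  end.

Fixpoint run (prog : seq instr) (ts : seq task) (M : seq pattern) : bool :=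
  if prog is i :: prog then
    if step i ts M is Some (ts, M) then run prog ts M else false
  else nilp ts.

Lemma fullP (P : pattern) x : full P x -> size (nbrs P x) = 3 /\ uniq (nbrs P x).
Proof.
rewrite /full; case: nbrs => [|a [|b [|c [|]]]] //; rewrite !eqnE !negb_or.
by case/and3P => ab ac bc; rewrite /= !inE negb_or ab ac bc.
Qed.

Lemma mem_without x y s : (y \in without x s) = (x != y) && (y \in s).
Proof. by rewrite mem_filter eqnE. Qed.

Lemma nbrs_add P x y i :
  nbrs (add_nbr P x y) i = if i == x then y :: nbrs P x else nbrs P i.
Proof. by rewrite /nbrs nth_set_nth /=; case: eqP. Qed.

Lemma colour_link P x y i : colour (link P x y) i = colour P i.
Proof.
have E Q a b : colour (add_nbr Q a b) i = colour Q i.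
  by rewrite /colour nth_set_nth /=; case: eqP => // ->.
by rewrite !E.
Qed.

Lemma mem_link P x y i j : x != y ->
  (j \in nbrs (link P x y) i) =
  [|| j \in nbrs P i, (i == x) && (j == y) | (i == y) && (j == x)].
Proof.
move=> xy; rewrite !nbrs_add.
have [->|iy] := eqVneq i y.
  by rewrite eq_sym (negbTE xy) inE orbC.
by have [->|ix] := eqVneq i x; rewrite /= ?inE ?orbF // orbC.
Qed.

(** * Soundness of the search moves *)

Section Soundness.
Variable G : cgraph.
Hypotheses (vG : v3 G) (conG : gconnected G) (irrG : irreducible G).

Let goal := isomorphic_to G heawood_adj \/ isomorphic_to G pappus_adj.

(* Only the edges are preserved: [f] may send non-adjacent vertices to adjacent
   ones, and it may exchange the two colours. *)
Definition embedding (P : pattern) (f : nat -> G) : Prop :=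
  [/\ {in gtn (order P) &, injective f},
      (forall i j, j \in nbrs P i -> [/\ i < order P, j < order P & cadj (f i) (f j)]) &
      exists c, forall i, i < order P -> ccol (f i) = c (+) colour P i].

Definition excluded (P : pattern) : Prop := forall f, embedding P f -> goal.

Section Embedding.
Variables (P : pattern) (f : nat -> G).
Hypothesis (fP : embedding P f).

Let n := order P.
Let finj : {in gtn n &, injective f}. Proof. by case: fP. Qed.

Lemma emb_adj i j : j \in nbrs P i -> [/\ i < n, j < n & cadj (f i) (f j)].
Proof. by case: fP => _ h _; apply: h. Qed.

Lemma emb_eq i j : i < n -> j < n -> (f i == f j) = (i == j).
Proof. by move=> li lj; apply/eqP/eqP => [/finj-> //|->]. Qed.

Lemma emb_mem j s : j < n -> all (gtn n) s -> (f j \in map f s) = (j \in s).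
Proof.
move=> lj /allP ls; apply/mapP/idP => [[i si /finj ->] //|sj]; last by exists j.
exact: ls.
Qed.

Lemma nbrs_lt i : all (gtn n) (nbrs P i).
Proof. by apply/allP => j /emb_adj[]. Qed.

Lemma full_adj i y : full P i -> cadj (f i) y = (y \in map f (nbrs P i)).
Proof.
case/fullP => s3 us; apply: (v3_adj_mem vG); first by rewrite size_map.
  rewrite map_inj_in_uniq // => j k hj hk; apply: finj; exact: (allP (nbrs_lt i)).
by apply/allP => _ /mapP[j hj ->]; case: (emb_adj hj).
Qed.

Lemma full_adj_nat i j : full P i -> j < n -> cadj (f i) (f j) = (j \in nbrs P i).
Proof. by move=> fi lj; rewrite full_adj // emb_mem // nbrs_lt. Qed.

Lemma blockedP x y : x < n -> y < n -> y \notin nbrs P x -> blocked P x y ->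
  cadj (f x) (f y) = false.
Proof.
move=> lx ly xy /or3P[fx|/andP[fy]|].
- by rewrite full_adj_nat // (negbTE xy).
- by rewrite memn_in => yx; rewrite (v3_adjC vG) full_adj_nat // (negbTE yx).
rewrite memn_in => /flattenP[_ /mapP[a xa ->]] /flattenP[_ /mapP[b ab ->]] yb.
have [_ la axa] := emb_adj xa; have [_ lb aab] := emb_adj ab; have [_ _ aby] := emb_adj yb.
apply/negP => axy.
have xb : f x != f b by rewrite emb_eq //; apply: contraNneq xy => ->.
have := v3_no_square vG xb axa _ axy aby; rewrite (v3_adjC vG) => /(_ aab) /eqP.
by rewrite emb_eq // => /eqP E; rewrite -E xa in xy.
Qed.

Lemma emb_link x y : x < n -> y < n -> cadj (f x) (f y) -> embedding (link P x y) f.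
Proof.
move=> lx ly xy.
have xNy : x != y by have := v3_adj_neq vG xy; rewrite emb_eq.
have sz : order (link P x y) = n.
  by rewrite /order !size_set_nth (maxn_idPr lx) (maxn_idPr ly).
have [_ _ [c fc]] := fP; split; rewrite ?sz //; last first.
  by exists c => i li; rewrite colour_link; apply: fc.
move=> i j; rewrite mem_link // => /or3P[/emb_adj //| |] /andP[/eqP-> /eqP->]; split=> //.
by rewrite (v3_adjC vG).
Qed.

End Embedding.

Lemma emb_extend P f x y : embedding P f -> x < order P -> cadj (f x) y ->
  (forall i, i < order P -> f i != y) ->
  embedding (extend P x) (fun i => if i == order P then y else f i).
Proof.
move=> fP lx xy fresh; set n := order P; have [finj fadj [c fc]] := fP.
have xn : (x == n) = false by rewrite ltn_eqF.
have lt i : i < n.+1 -> i != n -> i < n by rewrite ltnS ltn_neqAle => -> ->.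
apply: emb_link; rewrite /= ?eqxx ?xn /order ?size_rcons ?ltnS ?leqnn //; last exact: ltnW.
split; rewrite /order size_rcons -/(order P) -/n.
- move=> i j; rewrite !inE => li lj.
  have [->|iN] := eqVneq i n; have [->|jN] := eqVneq j n => //.
  + by move=> E; move: (fresh j (lt _ lj jN)); rewrite E eqxx.
  + by move=> E; move: (fresh i (lt _ li iN)); rewrite E eqxx.
  + by apply: finj; apply: lt.
- move=> i j; rewrite /nbrs nth_rcons -/(order P) -/n.
  case: ltnP => [li|_]; last by case: ifP.
  by move=> /fadj[_ lj ij]; split; [exact: leqW | exact: leqW | rewrite !ltn_eqF].
- exists c => i li; rewrite /colour nth_rcons -/(order P) -/n.
  have [->|iN] := eqVneq i n; last by rewrite lt //; apply: fc; apply: lt.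
  by rewrite ltnn /= (v3_adj_col vG xy) (fc _ lx) addbN.
Qed.

(** Both clauses of [admissible] range over finite sets, so their failure can be decided and yields
    explicit witnesses to branch on. *)
Lemma irreducible_detour (u v : G) ms : ccol v = ~~ ccol u -> is_matching u v ms ->
  (exists a b x y, [/\ (a, b) \in ms, cadj a x && (x != u), cadj b y && (y != v) & cadj x y]) \/
  (exists a b a' b', [/\ (a, b) \in ms, (a', b') \in ms, a != a', cadj a b' & cadj a' b]).
Proof.
move=> cvu mM.
have [/hasP[[a b] h /existsP[x /existsP[y /and3P[ax bY xy]]]]|H1] :=
  boolP (has (fun p : G * G => [exists x, exists y,
    [&& cadj p.1 x && (x != u), cadj p.2 y && (y != v) & cadj x y]]) ms).
  by left; exists a, b, x, y.
have [/hasP[[a b] h /hasP[[a' b'] h' /and3P[aa' ab' a'b]]]|H2] :=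
  boolP (has (fun p : G * G => has (fun q : G * G =>
    [&& p.1 != q.1, cadj p.1 q.2 & cadj q.1 p.2]) ms) ms).
  by right; exists a, b, a', b'.
case: (irreducible_not_admissible vG conG irrG cvu mM); split.
  move=> a b x y h ax xu bY yv; apply/negP => xy; move/hasP: H1; apply.
  exists (a, b) => //; apply/existsP; exists x; apply/existsP; exists y.
  by rewrite ax xu bY yv xy.
move=> a b a' b' h h' aa' ab' a'b; move/hasP: H2; apply.
exists (a, b) => //; apply/hasP; exists (a', b') => //; exact/and3P.
Qed.

(** The image of [x] has a neighbour outside the known ones. It is either the image of a pattern
    vertex, covered by a [link], or a vertex not yet met, covered by [extend]. *)
Lemma grow_sound P x : x < order P -> size (nbrs P x) < 3 ->
  (forall Q, Q \in grow P x -> excluded Q) -> excluded P.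
Proof.
move=> lx sx ex f fP.
have [|y xy yN] := @v3_new_nbr _ vG (f x) (map f (nbrs P x)); first by rewrite size_map.
have [/mapP[j + E]|fresh] := boolP (y \in map f (iota 0 (order P))).
  rewrite mem_iota add0n => /= lj; rewrite E in xy yN.
  apply: (ex (link P x j) _ f); last exact: emb_link.
  have jN : j \notin nbrs P x by rewrite -(emb_mem fP lj) ?(nbrs_lt fP).
  rewrite mem_rcons inE; apply/orP; right; apply/map_f.
  rewrite mem_filter mem_iota leq0n add0n lj !andbT memn_in jN /=; apply/andP; split.
    have [_ _ [c fc]] := fP; have := v3_adj_col vG xy; rewrite (fc _ lx) (fc _ lj).
    by case: c {fc}; case: (colour P x); case: (colour P j).
  by apply/negP => /(blockedP fP lx lj jN); rewrite xy.
apply: (ex (extend P x) _ _ (emb_extend fP lx xy _)).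
  by rewrite mem_rcons inE eqxx.
move=> i li; apply: contraNneq fresh => <-.
by apply: map_f; rewrite mem_iota.
Qed.

(** As [u], [v] and all matched vertices are full, the listed pairs map to a true perfect matching
    in [G], and every possible detour has its inner vertices among the images of pattern vertices.
    The branching is therefore exhaustive. *)
Lemma test_sound P u v bs : test_ok P u v bs ->
  (forall Q, Q \in test P u v bs -> excluded Q) -> excluded P.
Proof.
rewrite /test_ok; set us := without v _; set vs := without u _; set ms := zip us bs.
case/and5P => /andP[fu fv] cuv /and4P[/eqP su /eqP sv ub /allP bv].
move=> /andP[/allP fus /allP fbs] /andP[/allP open /allP sq] ex f fP.
have [finj fadj [c fc]] := fP.
have lu : u < order P.
  by have [+ _] := fullP fu;
     case E: (nbrs P u) => [//|i s] _; case: (fadj u i); rewrite ?E ?mem_head.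
have lv : v < order P.
  by have [+ _] := fullP fv;
     case E: (nbrs P v) => [//|i s] _; case: (fadj v i); rewrite ?E ?mem_head.
(* A duplicate-free sublist of the same size exhausts [vs], so [bs] is a reordering of it. *)
have vsb : bs =i vs.
  have sub : {subset bs <= vs} by move=> b /bv; rewrite memn_in.
  by have [_] := uniq_min_size ub sub (eq_leq sv).
have lus : all (gtn (order P)) us.
  by apply/allP => a; rewrite mem_without => /andP[_ /fadj[]].
have lbs : all (gtn (order P)) bs.
  by apply/allP => b; rewrite vsb mem_without => /andP[_ /fadj[]].
have msP a b : (a, b) \in ms -> a \in us /\ b \in bs.
  move=> h; split; first by rewrite -(unzip1_zip (eq_leq su)); apply: (map_f fst h).
  by rewrite -(unzip2_zip (eq_leq (esym su))); apply: (map_f snd h).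
pose fms := zip (map f us) (map f bs).
have fmsP a b : (a, b) \in fms -> exists i j, [/\ (i, j) \in ms, a = f i & b = f j].
  have zipE s t : zip (map f s) (map f t) = [seq (f p.1, f p.2) | p <- zip s t].
    by elim: s t => [|k s IH] [|l t] //=; rewrite IH.
  rewrite /fms zipE => /mapP[[i j] h [-> ->]].
  by exists i, j.
have infj s : all (gtn (order P)) s -> uniq s -> uniq (map f s).
  move=> /allP ls us'; rewrite map_inj_in_uniq // => i j si sj; apply: finj; exact: ls.
have mM : is_matching (f u) (f v) fms.
  have s12 : size (map f us) = size (map f bs) by rewrite !size_map.
  split; rewrite ?unzip1_zip ?unzip2_zip ?s12 //.
  - by apply: infj => //; apply: filter_uniq; case: (fullP fu).
  - exact: infj.
  - move=> a; rewrite (full_adj fP) //; apply/mapP/andP => [[i hi ->]|[/mapP[i hi ->]]].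
      move: (hi); rewrite mem_without => /andP[vi ui]; split; first exact: map_f.
      by rewrite (emb_eq fP) // 1?eq_sym //; exact: (allP lus).
    rewrite (emb_eq fP) // => [iv|]; last by case: (fadj _ _ hi).
    by exists i => //; rewrite mem_without hi eq_sym iv.
  - move=> b; rewrite (full_adj fP) //; apply/mapP/andP => [[i hi ->]|[/mapP[i hi ->]]].
      move: (hi); rewrite vsb mem_without => /andP[ui vi]; split; first exact: map_f.
      by rewrite (emb_eq fP) // 1?eq_sym //; exact: (allP lbs).
    rewrite (emb_eq fP) // => [iu|]; last by case: (fadj _ _ hi).
    by exists i => //; rewrite vsb mem_without hi eq_sym iu.
have cvu : ccol (f v) = ~~ ccol (f u).
  by rewrite (fc _ lu) (fc _ lv); move: cuv; case: c {fc} (colour P u) (colour P v) => [] [] [].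
have [[a [b [x [y []]]]]|[a [b [a' [b' []]]]]] := irreducible_detour cvu mM.
  case/fmsP => i [j [h -> ->]] {a b}; have [iu jb] := msP _ _ h.
  case/andP; rewrite (full_adj fP) ?fus // => /mapP[s hs ->] {x} su'.
  case/andP; rewrite (full_adj fP) ?fbs // => /mapP[t ht ->] {y} tv st.
  have [_ ls _] := fadj _ _ hs; have [_ lt _] := fadj _ _ ht.
  rewrite (emb_eq fP) // in su'; rewrite (emb_eq fP) // in tv.
  have det : (s, t) \in detours P u v ms.
    apply/flattenP; exists [seq (x, y) | x <- without u (nbrs P i), y <- without v (nbrs P j)].
      by apply/mapP; exists (i, j).
    by apply: allpairs_f; rewrite mem_without eq_sym ?su' ?tv.
  apply: (ex (link P s t) _ f); last exact: emb_link.
  apply/mapP; exists (s, t) => //; rewrite mem_filter det andbT /=.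
  have := open _ det; rewrite memn_in /= => tN.
  by apply/negP => /(blockedP fP ls lt tN); rewrite st.
case/fmsP => i [j [h -> ->]] {a b}; case/fmsP => i' [j' [h' -> ->]] {a' b'}.
have [iu jb] := msP _ _ h; have [iu' jb'] := msP _ _ h'.
have [li li'] := (allP lus _ iu, allP lus _ iu'); have [lj lj'] := (allP lbs _ jb, allP lbs _ jb').
rewrite (emb_eq fP) // (full_adj_nat fP) ?fus // (full_adj_nat fP) ?fus // => ii' ij' i'j.
have /allP/(_ _ h') := sq _ h; rewrite /= !memn_in ij' i'j !orbF eqnE.
by rewrite (negbTE ii').
Qed.

Lemma subpattern_sound Q P g : subpattern Q P g -> excluded Q -> excluded P.
Proof.
case/and5P => /eqP sg ug /allP lg /allP adjg /allP colg exQ f fP.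
have [finj fadj [c fc]] := fP.
have lt i : i < order Q -> nth 0 g i < order P.
  by move=> li; apply: lg; rewrite mem_nth // sg.
apply: (exQ (fun i => f (nth 0 g i))); split.
- move=> i j li lj /finj; rewrite !inE => /(_ (lt _ li) (lt _ lj)) /eqP.
  by rewrite nth_uniq ?sg // => /eqP.
- move=> i j ij.
  have li : i < order Q.
    by move: ij; rewrite /nbrs; case: ltnP => // /(nth_default (false, [::])) ->.
  have := adjg i; rewrite mem_iota li => /(_ isT)/allP/(_ _ ij)/andP[lj].
  by rewrite memn_in => /fadj[].
- exists (c (+) (colour Q 0 (+) colour P (nth 0 g 0))) => i li.
  rewrite fc ?lt //; have := colg i; rewrite mem_iota li => /(_ isT) /=.
  by case: c {fc} (colour Q 0) (colour P _) (colour Q i) (colour P _) => [] [] [] [] [].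
Qed.

(** All vertices are full, so the image of the pattern is closed under adjacency and, [G] being
    connected, is the whole graph. Fullness also makes non-edges of the pattern non-edges of [G]. *)
Lemma lcf_sound P n off g : 0 < n -> is_lcf P n off g -> forall f, embedding P f ->
  isomorphic_to G (@lcf_adj n off).
Proof.
move=> n_gt0 /and5P[/eqP sP /eqP sg ug /allP lg /andP[/allP fu /allP adjg]] f fP.
have [finj fadj _] := fP; rewrite sP in finj fadj.
have lt (i : 'I_n) : nth 0 g i < n by apply: lg; rewrite mem_nth // sg.
pose h (i : 'I_n) := f (nth 0 g i).
have hinj : injective h.
  move=> i j /finj; rewrite !inE => /(_ (lt _) (lt _)) /eqP.
  by rewrite nth_uniq ?sg // => /eqP/val_inj.
have hadj i j : cadj (h i) (h j) = lcf_adj off i j.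
  rewrite (full_adj_nat fP) ?sP ?lt //; last by apply: fu; rewrite mem_iota lt.
  have := adjg i; rewrite mem_iota ltn_ord => /(_ isT)/allP/(_ j).
  rewrite mem_iota ltn_ord => /(_ isT).
  by rewrite memn_in; case: (_ \in _); rewrite /= ?negbK // => /negbTE.
have hsurj x : x \in codom h.
  suff: x \in [set y in codom h] by rewrite inE.
  apply: (connected_closed conG (s := h (Ordinal n_gt0))); first by rewrite inE codom_f.
  move=> z y; rewrite !inE => /codomP[i ->].
  rewrite (full_adj fP); last by apply: fu; rewrite mem_iota lt.
  case/mapP => j /fadj[_ lj _] ->; have: j \in g.
    have sub : {subset g <= iota 0 n} by move=> k /lg lk; rewrite mem_iota.
    by have [|_ ->] := uniq_min_size ug sub; rewrite ?size_iota ?sg ?mem_iota.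
  case/(nthP 0) => k lk <-; rewrite sg in lk.
  exact: (codom_f h (Ordinal lk)).
have hbij : bijective h.
  apply: (inj_card_bij hinj); rewrite -(card_codom hinj).
  by apply/subset_leq_card/subsetP => x _; apply: hsurj.
have [F hF Fh] := hbij; exists F; split; first by exists h.
by move=> x y; rewrite -hadj !Fh.
Qed.

(** [Remember P] is read as a premise for what lies below it. [Keep] places it right under
    [Prove P], so the premise is available when [Store] adds [P] to the memory. *)
Fixpoint holds (ts : seq task) : Prop :=
  match ts with
  | [::] => True
  | Prove P :: ts => excluded P /\ holds ts
  | Remember P :: ts => excluded P -> holds ts
  end.

Lemma holds_cat Ps ts : holds (map Prove Ps ++ ts) ->
  (forall Q, Q \in Ps -> excluded Q) /\ holds ts.
Proof.
elim: Ps => [|P Ps IH] //= [exP /IH[exPs hts]]; split=> // Q.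
by rewrite inE => /predU1P[-> //|/exPs].
Qed.

Lemma run_sound prog ts M : (forall P, P \in M -> excluded P) -> run prog ts M -> holds ts.
Proof.
elim: prog ts M => [|i prog IH] ts M okM /=; first by case: ts.
case: i => [x|u v bs|||k g|g|g]; case: ts => [|[P|P] ts] //=.
- case: ifP => // /andP[lx sx] /IH - /(_ okM) /holds_cat[ex hts]; split=> //.
  exact: grow_sound ex.
- case: ifP => // ok /IH - /(_ okM) /holds_cat[ex hts]; split=> //.
  exact: test_sound ex.
- by move=> /IH - /(_ okM) /= [exP /(_ exP)].
- move=> h exP; apply: IH h => Q; rewrite mem_rcons inE => /predU1P[-> //|]; exact: okM.
- case: ifP => // /andP[lk sub] /IH - /(_ okM) hts; split=> //.
  by apply: subpattern_sound sub _; apply/okM/mem_nth.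
- case: ifP => // ok /IH - /(_ okM) hts; split=> // f fP.
  by left; apply: (lcf_sound _ ok fP).
- case: ifP => // ok /IH - /(_ okM) hts; split=> // f fP.
  by right; apply: (lcf_sound _ ok fP).
Qed.

End Soundness.

(** * The recorded search tree *)

Section Certificate.

Local Notation G := Grow.
Local Notation T := Test.
Local Notation K := Keep.
Local Notation S := Store.
Local Notation U := Use.
Local Notation H := Heawood.
Local Notation P := Pappus.

(* Found by a computer search for a small tree. *)
Definition certificate : seq instr := [::
G 0; G 0; G 0; G 1; G 1; G 2; G 2; G 3; G 3; G 4; G 4; G 5; G 5; T 0 1 [::4;5]; K; G 9; K; G 8; K; G
8; K; G 10; K; G 6; K; G 11; K; G 7; H [::0;3;9;12;6;2;7;11;4;10;8;13;5;1]; G 13; G 14; K; G 14; G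
15; G 16; G 16; T 5 14 [::7;16;15]; S; G 16; G 16; G 14; U 0
[::0;3;2;1;9;8;6;7;5;4;12;11;10;13;14;15]; G 19; G 19; T 5 14 [::7;19;16]; S; G 7; U 1
[::0;3;2;1;8;9;6;7;4;5;10;13;12;11]; G 7; U 1 [::0;3;2;1;8;9;6;7;4;5;10;13;12;11]; G 13; U 1
[::1;5;0;4;12;13;3;2;11;10;9;6;8;14]; G 14; K; G 14; G 15; G 16; G 16; T 7 2 [::6;0]; G 19; G 19; T
0 15 [::19;14;7]; S; U 2 [::0;3;2;1;9;8;6;7;5;4;12;11;10;13;14;16;15;17]; G 14; U 2
[::0;3;2;1;9;8;6;7;5;4;12;11;10;13;14;15;16;17]; U 2
[::0;3;2;1;9;8;6;7;5;4;12;11;10;13;14;16;15;17]; G 15; U 2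
[::0;3;2;1;8;9;6;7;4;5;10;13;12;11;17;15;16;14]; G 15; U 2
[::0;3;2;1;8;9;6;7;4;5;10;13;12;11;17;15;16;14]; G 16; U 2
[::0;3;2;1;8;9;6;7;4;5;10;13;12;11;17;16;15;14]; G 16; U 2
[::0;3;2;1;8;9;6;7;4;5;10;13;12;11;17;16;15;14]; T 7 2 [::6;0]; S; G 14; G 14; G 7; K; G 7; U 3
[::0;3;2;1;9;8;7;6;4;5;11;12;13;10]; G 12; K; G 13; K; G 15; G 16; T 5 14 [::15;6;16]; G 18; G 18; T
15 10 [::8;6;4]; S; G 15; U 4 [::1;0;5;4;3;2;12;13;11;10;9;8;6;7;15;14;17;18]; G 16; K; G 16; T 6 14
[::16;15]; S; G 16; U 5 [::0;1;2;3;4;5;6;7;8;9;10;11;12;13;14;15;16;17;18;19]; T 6 14 [::16;15]; S;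
U 6 [::0;1;2;3;4;5;6;7;8;9;10;11;12;13;14;16;15;17]; G 18; K; G 18; G 13; K; G 15; U 6
[::0;1;2;3;4;5;7;6;9;8;11;10;13;12;17;15;18;14]; G 19; T 15 2 [::6;7;0]; G 20; G 20; T 15 2
[::6;7;0]; S; U 7 [::0;1;2;3;4;5;6;7;8;9;10;11;12;13;14;16;15;17;18;19]; G 20; U 6
[::0;1;2;3;4;5;7;6;9;8;11;10;13;12;17;20;18;14]; K; G 20; G 17; K; G 15; T 5 17 [::7;15;18]; T 5 17
[::7;15;18]; S; U 8 [::0;1;2;3;4;5;6;7;8;9;10;11;12;13;14;16;15;17;18;19;20;21]; G 22; K; G 22; T 5
17 [::7;22;18]; S; G 22; U 9 [::0;1;2;3;4;5;6;7;8;9;10;11;12;13;14;16;15;17;18;19;20;21;22]; T 5 17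
[::7;22;18]; S; G 20; U 6 [::0;1;2;3;4;5;7;6;9;8;11;10;13;12;17;20;18;14]; U 10
[::0;1;2;3;4;5;6;7;8;9;10;11;12;13;14;16;15;17;18;19;20]; G 17; U 10
[::1;0;5;4;3;2;13;12;10;11;8;9;7;6;20;22;21;18;17;15;14]; U 10
[::1;0;5;4;3;2;13;12;10;11;8;9;7;6;20;22;21;18;17;16;14]; G 19; K; G 19; T 18 2 [::7;0;6]; S; U 11
[::0;1;2;3;4;5;6;7;8;9;10;11;12;13;14;16;15;17;18;19;20;22;21;23]; G 19; U 11
[::0;1;2;3;4;5;6;7;8;9;10;11;12;13;14;15;16;17;18;19;20;22;21;23]; U 11
[::0;1;2;3;4;5;6;7;8;9;10;11;12;13;14;16;15;17;18;19;20;22;21;23]; T 18 2 [::7;0;6]; S; G 18; U 12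
[::0;1;2;3;4;5;6;7;8;9;10;11;12;13;14;16;15;17;18]; G 13; U 12
[::1;0;5;4;3;2;12;13;11;10;9;8;6;7;18;20;19;15;14]; U 12
[::1;0;5;4;3;2;12;13;11;10;9;8;6;7;18;20;19;16;14]; G 15; K; G 17; U 6
[::0;1;2;3;4;5;7;6;9;8;11;10;13;12;17;21;15;14]; G 15; K; G 16; K; G 16; T 6 14 [::15;16]; S; G 16;
U 13 [::0;1;2;3;4;5;6;7;8;9;10;11;12;13;14;15;16;17;18;19;20;21;22]; T 6 14 [::15;16]; S; U 14
[::0;1;2;3;4;5;6;7;8;9;10;11;12;13;14;15;16;17;18;20;19;21;22]; G 23; K; G 23; T 15 2 [::7;6;0]; S;
G 23; U 15 [::0;1;2;3;4;5;6;7;8;9;10;11;12;13;14;15;16;17;18;20;19;21;22;23]; T 15 2 [::7;6;0]; S;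
K; G 15; U 16 [::0;1;2;3;4;5;6;7;8;9;10;11;12;13;14;15;16;17;18;20;19;21]; G 19; U 16
[::1;0;5;4;3;2;12;13;11;10;9;8;6;7;18;19;20;21;14;16;15;17]; G 22; K; G 22; T 15 1 [::4;0;5]; S; G
22; U 17 [::0;1;2;3;4;5;6;7;8;9;10;11;12;13;14;15;16;17;18;19;20;21;22;23]; T 15 1 [::4;0;5]; S; U
18 [::0;1;2;3;4;5;6;7;8;9;10;11;12;13;14;15;16;17;18;20;19;21]; G 15; U 16
[::0;1;2;3;4;5;6;7;8;9;10;11;12;13;14;15;16;17;18;20;19;21]; U 18
[::0;1;2;3;4;5;6;7;8;9;10;11;12;13;14;15;16;17;18;19;20;21]; U 18
[::0;1;2;3;4;5;6;7;8;9;10;11;12;13;14;15;16;17;18;20;19;21]; G 19; U 18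
[::0;1;2;3;4;5;6;7;8;9;10;11;12;13;14;16;15;17;18;19;20;21]; U 16
[::1;0;5;4;3;2;12;13;11;10;9;8;6;7;18;19;20;21;14;16;15;17]; G 19; U 18
[::0;1;2;3;4;5;6;7;8;9;10;11;12;13;14;16;15;17;18;19;20;21]; U 16
[::1;0;5;4;3;2;12;13;11;10;9;8;6;7;18;19;20;21;14;16;15;17]; G 16; U 16
[::0;1;2;3;4;5;6;7;8;9;10;11;12;13;14;16;15;17;18;20;19;21]; U 18
[::0;1;2;3;4;5;6;7;8;9;10;11;12;13;14;16;15;17;18;20;19;21]; G 16; U 16
[::0;1;2;3;4;5;6;7;8;9;10;11;12;13;14;16;15;17;18;20;19;21]; U 18
[::0;1;2;3;4;5;6;7;8;9;10;11;12;13;14;16;15;17;18;20;19;21]; T 6 14 [::16;15]; S; K; G 7; T 6 2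
[::0;7]; S; U 19 [::0;3;2;1;8;9;6;7;4;5;10;13;12;11;14;16;15]; G 7; U 19
[::0;1;2;3;4;5;6;7;8;9;10;11;12;13;14;16;15]; U 20 [::0;3;2;1;8;9;6;7;4;5;10;13;12;11;14;16;15]; U
19 [::0;3;2;1;8;9;6;7;4;5;10;13;12;11;14;16;15]; T 6 2 [::0;7]; S; U 21
[::0;3;2;1;8;9;7;6;4;5;10;13;12;11]; G 11; U 21 [::0;3;2;1;9;8;6;7;4;5;11;12;13;10]; U 21
[::0;3;2;1;9;8;7;6;4;5;11;12;13;10]; G 6; U 21 [::0;3;2;1;9;8;6;7;5;4;12;11;10;13]; U 21
[::0;3;2;1;8;9;6;7;5;4;13;10;11;12]; G 6; U 21 [::0;3;2;1;9;8;6;7;5;4;12;11;10;13]; U 21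
[::0;3;2;1;8;9;6;7;5;4;13;10;11;12]; G 7; U 21 [::0;3;2;1;9;8;7;6;5;4;12;11;10;13]; U 21
[::0;3;2;1;8;9;7;6;5;4;13;10;11;12]; G 7; U 21 [::0;3;2;1;9;8;7;6;5;4;12;11;10;13]; U 21
[::0;3;2;1;8;9;7;6;5;4;13;10;11;12]; T 0 2 [::7;6]; S; G 10; K; G 11; U 22
[::1;4;5;0;11;10;13;12;3;2;9;7;6;8]; T 4 3 [::0;9;8]; G 7; K; G 7; U 22
[::2;6;7;0;12;10;14;13;3;1;9;5;4;8]; U 22 [::2;6;7;0;12;10;16;13;3;1;9;5;4;8]; S; U 23
[::0;3;2;1;9;8;6;7;5;4;12;11;10;14;13;15]; G 7; U 23 [::0;1;2;3;4;5;6;7;8;9;10;11;12;13;14;15]; U 23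
[::0;3;2;1;9;8;6;7;5;4;12;11;10;14;13;15]; U 22 [::2;6;7;0;12;10;17;16;3;1;9;5;4;8]; S; U 24
[::0;1;2;3;4;5;7;6;8;9;10;11;12;13;14]; G 12; U 24 [::0;3;2;1;9;8;6;7;5;4;12;11;10;14;13]; U 24
[::0;3;2;1;9;8;7;6;5;4;12;11;10;14;13]; K; G 15; G 11; K; G 6; U 24
[::1;4;5;0;11;10;13;12;2;3;6;9;8;15;7]; U 24 [::3;9;8;0;11;12;14;10;2;1;6;4;5;15;7]; U 24
[::4;11;10;1;9;6;15;8;5;0;12;3;2;16;13]; U 24 [::4;11;10;1;9;6;15;8;5;0;12;3;2;17;13]; S; U 25
[::0;3;2;1;9;8;7;6;5;4;12;11;10;14;13;15;16]; G 6; K; G 13; U 25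
[::5;12;13;1;9;15;17;6;0;4;3;11;10;16;2;8;14]; G 6; K; G 14; U 25
[::8;10;14;3;4;15;17;6;0;9;1;11;12;16;2;5;13]; T 6 1 [::5;0;4]; S; U 26
[::5;1;13;12;4;0;6;18;15;9;10;11;3;2;16;8;14;17;7]; G 19; K; G 19; T 6 1 [::5;0;4]; S; G 19; U 27
[::0;1;2;3;4;5;6;7;8;9;10;11;12;13;14;15;16;17;18;19]; T 6 1 [::5;0;4]; S; U 28
[::0;3;2;1;9;8;6;7;5;4;12;11;10;14;13;15;16;17]; K; G 16; U 25
[::15;12;16;10;9;5;17;6;8;4;3;11;1;13;14;0;2]; G 6; U 28
[::0;1;2;3;4;5;6;7;8;9;10;11;12;13;14;15;16;17]; U 28
[::0;3;2;1;9;8;6;7;5;4;12;11;10;14;13;15;16;17]; G 7; U 28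
[::0;1;2;3;4;5;7;6;8;9;10;11;12;13;14;15;16;17]; U 28
[::0;3;2;1;9;8;7;6;5;4;12;11;10;14;13;15;16;17]; G 7; U 28
[::0;1;2;3;4;5;7;6;8;9;10;11;12;13;14;15;16;17]; U 28
[::0;3;2;1;9;8;7;6;5;4;12;11;10;14;13;15;16;17]; T 0 2 [::7;6]; S; G 6; U 28
[::0;1;2;3;4;5;6;7;8;9;10;11;12;13;14;15;16;17]; U 28
[::0;3;2;1;9;8;6;7;5;4;12;11;10;14;13;15;16;17]; U 29
[::0;3;2;1;9;8;6;7;5;4;12;11;10;14;13;15;16;17]; G 7; U 28
[::0;1;2;3;4;5;7;6;8;9;10;11;12;13;14;15;16;17]; U 28
[::0;3;2;1;9;8;7;6;5;4;12;11;10;14;13;15;16;17]; U 29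
[::0;3;2;1;9;8;7;6;5;4;12;11;10;14;13;15;16;17]; G 7; U 28
[::0;1;2;3;4;5;7;6;8;9;10;11;12;13;14;15;16;17]; U 28
[::0;3;2;1;9;8;7;6;5;4;12;11;10;14;13;15;16;17]; U 29
[::0;3;2;1;9;8;7;6;5;4;12;11;10;14;13;15;16;17]; T 0 2 [::7;6]; S; G 15; K; G 15; T 0 10 [::15;4;8];
K; G 13; K; G 6; K; G 7; K; G 14; T 8 10 [::4;15]; T 8 10 [::4;15]; S; G 14; U 31
[::1;0;5;4;3;2;13;12;10;11;8;9;7;6;15;14;18;16]; T 6 10 [::4;8;15]; S; G 7; U 30
[::1;4;5;0;11;10;13;12;2;3;7;9;8;15;6;14]; U 32 [::4;1;10;11;0;5;15;8;7;9;2;3;12;13;17;6;16;18]; G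
14; K; G 14; T 8 10 [::4;15]; S; G 14; U 33 [::0;1;2;3;4;5;6;7;8;9;10;11;12;13;14;15;16;17;18;19]; T
8 10 [::4;15]; S; U 30 [::3;9;8;0;11;12;14;10;2;1;7;4;5;16;6;13]; G 7; U 30
[::1;4;5;0;11;10;13;12;2;3;7;9;8;15;6;14]; U 34 [::11;4;7;9;1;10;17;2;12;3;5;0;8;15;16;13;14;18]; G
6; K; G 6; K; G 17; T 15 1 [::4;0;5]; T 15 1 [::4;0;5]; S; G 14; U 34
[::9;3;12;11;0;8;16;5;7;4;2;1;10;14;19;6;15;20]; U 35
[::1;0;5;4;3;2;13;12;10;11;8;9;7;6;15;14;19;18;20;16]; T 8 10 [::4;15]; S; K; G 6; U 36
[::0;1;2;3;4;5;6;7;8;9;10;11;12;13;14;15;16;17;18;19]; G 17; T 15 1 [::4;0;5]; T 15 1 [::4;0;5]; S;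
G 6; U 36 [::0;1;2;3;4;5;6;7;8;9;10;11;12;13;14;15;16;17;18;19]; U 37
[::0;1;2;3;4;5;6;7;8;9;10;11;12;13;14;15;16;17;18;19]; G 19; U 36
[::11;4;7;9;1;10;19;2;12;3;5;0;8;15;16;13;14;18;17;6]; U 37
[::11;4;7;9;1;10;19;2;12;3;5;0;8;15;16;13;14;18;17;6]; G 19; U 36
[::11;4;7;9;1;10;19;2;12;3;5;0;8;15;16;13;14;18;17;6]; U 37
[::11;4;7;9;1;10;19;2;12;3;5;0;8;15;16;13;14;18;17;6]; T 7 2 [::0;6]; S; U 38
[::0;1;2;3;4;5;7;6;8;9;10;11;12;13;14;15;16;17]; S; G 15; U 39
[::0;1;2;3;4;5;7;6;8;9;10;11;12;13;14;15;16]; T 0 10 [::15;4;8]; K; G 7; U 30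
[::3;9;8;0;11;12;14;10;2;1;7;4;5;16;6;13]; U 30 [::1;4;5;0;11;10;13;12;2;3;7;9;8;15;6;14]; U 39
[::1;4;5;0;11;10;13;12;2;3;7;9;8;15;6;17;14]; U 39 [::1;4;5;0;11;10;13;12;2;3;7;9;8;15;6;18;14]; G
13; U 39 [::3;0;8;9;1;2;14;10;12;11;5;4;7;6;16;13;19]; G 13; U 39
[::3;0;8;9;1;2;14;10;12;11;5;4;7;6;16;13;19]; G 6; U 39
[::1;0;5;4;3;2;13;12;10;11;8;9;7;6;15;14;19]; K; G 6; U 39
[::1;0;5;4;3;2;13;12;10;11;8;9;7;6;15;14;19]; G 14; U 39
[::0;3;2;1;9;8;7;6;5;4;12;11;10;14;13;16;15]; K; G 14; U 39
[::0;3;2;1;9;8;7;6;5;4;12;11;10;14;13;16;15]; T 8 10 [::4;15]; S; U 40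
[::0;1;2;3;4;5;6;7;8;9;10;11;12;13;14;15;16;17;18;19;21;20;22]; G 14; U 39
[::0;3;2;1;9;8;7;6;5;4;12;11;10;14;13;16;15]; U 40
[::0;1;2;3;4;5;6;7;8;9;10;11;12;13;14;15;16;17;18;19;20;21;22]; U 40
[::0;1;2;3;4;5;6;7;8;9;10;11;12;13;14;15;16;17;18;19;21;20;22]; T 8 10 [::4;15]; S; U 41
[::0;1;2;3;4;5;6;7;8;9;10;11;12;13;14;15;16;18;17;19;21;20]; G 6; U 39
[::1;0;5;4;3;2;13;12;10;11;8;9;7;6;15;14;19]; U 41
[::0;1;2;3;4;5;6;7;8;9;10;11;12;13;14;15;16;17;18;19;21;20]; U 41
[::0;1;2;3;4;5;6;7;8;9;10;11;12;13;14;15;16;18;17;19;21;20]; G 14; U 39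
[::0;3;2;1;9;8;7;6;5;4;12;11;10;14;13;16;15]; U 41
[::3;0;8;9;1;2;14;10;12;11;5;4;7;6;16;13;19;20;21;15;23;22]; U 41
[::3;0;8;9;1;2;14;10;12;11;5;4;7;6;16;13;19;21;20;15;23;22]; G 14; U 39
[::0;3;2;1;9;8;7;6;5;4;12;11;10;14;13;16;15]; U 41
[::1;0;5;4;3;2;13;12;10;11;8;9;7;6;15;14;19;20;24;16;23;22]; U 41
[::1;0;5;4;3;2;13;12;10;11;8;9;7;6;15;14;19;21;24;16;23;22]; T 8 10 [::4;15]; S; U 42
[::0;1;2;3;4;5;7;6;8;9;10;11;12;13;14;15;16;18;17]; S; U 43 [::0;1;2;3;5;4;7;6;8;9;13;12;11;10]; G
8; U 43 [::0;3;2;1;9;8;7;6;5;4;12;11;10;14]; U 43 [::0;3;2;1;9;8;7;6;4;5;11;12;13;14]; T 0 3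
[::9;8]; U 43 [::3;0;8;9;1;2;15;14;11;12;4;5;7;6]; U 43 [::3;0;8;9;1;2;15;14;12;11;5;4;7;6]; U 43
[::3;0;8;9;1;2;15;14;11;12;4;5;6;7]; U 43 [::3;0;8;9;1;2;15;14;12;11;5;4;6;7]; S; U 44
[::0;1;2;3;5;4;7;6;8;9;12;13;11;10]; G 11; U 44 [::1;0;5;4;3;2;13;12;10;11;8;9;6;7]; U 44
[::1;0;5;4;3;2;13;12;10;11;8;9;7;6]; T 0 1 [::5;4]; K; G 8; U 44
[::0;3;2;1;9;8;7;6;5;4;14;11;10;13]; G 13; U 44 [::1;0;4;5;3;2;11;10;12;13;9;8;6;7]; U 44
[::1;0;4;5;3;2;11;10;12;13;9;8;7;6]; K; G 15; G 10; K; G 10; G 12; U 44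
[::0;1;3;2;5;4;9;8;7;6;13;12;10;11]; K; G 12; K; G 6; G 14; T 6 13 [::5;8;15]; K; G 7; G 16; T 8 2
[::0;6;7]; T 8 2 [::0;6;7]; G 16; T 8 2 [::0;6;7]; T 8 2 [::0;6;7]; S; U 45
[::4;1;10;11;0;5;6;18;15;9;2;3;12;13;14;8;17;16;7;19]; K; G 16; T 6 13 [::5;8;15]; T 6 3 [::0;8;9];
S; U 46 [::4;1;10;11;0;5;6;18;15;9;2;3;12;13;14;8;17;16;7]; G 19; G 19; T 6 3 [::0;8;9]; U 46
[::5;1;12;13;4;0;18;7;8;15;10;11;2;3;17;9;16;14;6]; U 46
[::0;1;2;3;5;4;7;6;9;8;12;13;10;11;16;15;14;17;18]; S; G 6; K; G 14; K; G 7; U 47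
[::1;0;5;4;3;2;13;12;10;11;8;9;7;6;15;14;18;19;16]; G 17; T 7 1 [::0;4;5]; T 7 1 [::0;4;5]; G 20; K;
G 20; T 7 1 [::0;4;5]; S; G 20; U 48 [::0;1;2;3;4;5;6;7;8;9;10;11;12;13;14;15;16;17;18;19;20]; T 7 1
[::0;4;5]; S; T 6 13 [::5;8;15]; G 18; U 49 [::11;4;15;9;1;10;13;17;14;3;5;0;18;6;8;2;20;7;12;16]; T
5 10 [::6;4;18]; U 49 [::1;0;5;4;3;2;13;12;10;11;8;9;7;6;15;14;18;20;16;17]; S; K; G 16; T 6 3
[::0;8;9]; T 6 11 [::4;9;15]; G 18; U 44 [::4;11;1;10;15;9;5;0;6;18;13;17;14;3]; T 4 10 [::6;18]; T
6 3 [::0;8;9]; T 6 13 [::5;8;15]; S; K; G 7; U 51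
[::0;1;2;3;5;4;7;6;9;8;12;13;10;11;16;15;14;17;19;18]; U 50
[::0;1;2;3;5;4;7;6;9;8;12;13;10;11;16;15;14;17;19;18]; G 17; T 6 1 [::0;5;4]; T 6 1 [::0;5;4]; S; G
7; U 51 [::0;1;2;3;5;4;7;6;9;8;12;13;10;11;16;15;14;17;19;18]; U 50
[::0;1;2;3;5;4;7;6;9;8;12;13;10;11;16;15;14;17;19;18]; U 52
[::0;1;2;3;5;4;7;6;9;8;12;13;10;11;16;15;14;17;19;18]; G 20; K; G 20; T 6 1 [::0;5;4]; S; G 20; U 53
[::0;1;2;3;4;5;6;7;8;9;10;11;12;13;14;15;16;17;18;19;20;21]; T 6 1 [::0;5;4]; S; U 54
[::4;1;10;11;0;5;6;18;15;9;2;3;12;13;14;8;17;16;7]; G 12; U 44 [::0;1;3;2;5;4;9;8;7;6;13;12;10;11];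
U 54 [::0;1;2;3;5;4;7;6;9;8;12;13;10;11;16;15;14;17;19]; U 54
[::4;1;10;11;5;0;18;6;9;15;12;13;2;3;17;8;14;16;19]; G 6; G 7; K; G 14; U 54
[::0;3;2;1;9;8;6;7;5;4;14;11;16;13;10;15;12;17;19]; U 54
[::0;3;2;1;9;8;6;7;5;4;14;11;16;13;10;15;12;17;20]; U 54
[::0;3;2;1;9;8;6;7;5;4;14;11;16;13;10;15;12;17;21]; S; K; G 7; U 55
[::0;1;2;3;4;5;6;7;8;9;10;11;12;13;14;15;16;17;18;20;19]; T 5 2 [::6;0;7]; S; G 7; U 55
[::0;1;2;3;4;5;6;7;8;9;10;11;12;13;14;15;16;17;18;20;19]; U 56
[::0;1;2;3;4;5;6;7;8;9;10;11;12;13;14;15;16;17;18;20;19]; T 5 2 [::6;0;7]; K; G 7; K; G 16; U 54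
[::0;3;2;1;8;9;6;7;4;5;16;13;14;11;12;15;10;17;19]; U 54
[::0;3;2;1;8;9;6;7;4;5;16;13;14;11;12;15;10;17;20]; U 54
[::0;3;2;1;8;9;6;7;4;5;16;13;14;11;12;15;10;17;21]; S; K; G 7; U 57
[::0;1;2;3;4;5;6;7;8;9;10;11;12;13;14;15;16;17;18;20;19]; T 4 2 [::6;0;7]; S; G 7; U 57
[::0;1;2;3;4;5;6;7;8;9;10;11;12;13;14;15;16;17;18;20;19]; U 58
[::0;1;2;3;4;5;6;7;8;9;10;11;12;13;14;15;16;17;18;20;19]; T 4 2 [::6;0;7]; S; U 59
[::4;1;10;11;0;5;6;18;15;9;2;3;12;13;14;8;17;16;7;20;19]; G 21; K; G 21; T 6 1 [::4;0;5]; S; U 60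
[::0;1;2;3;4;5;6;7;8;9;10;11;12;13;14;15;16;17;18;20;19;21]; G 21; U 60
[::0;1;2;3;4;5;6;7;8;9;10;11;12;13;14;15;16;17;18;19;20;21]; U 60
[::0;1;2;3;4;5;6;7;8;9;10;11;12;13;14;15;16;17;18;20;19;21]; T 6 1 [::4;0;5]; S; U 61
[::0;1;2;3;4;5;7;6;8;9;10;11;12;13;14;15;16;17]; G 10; U 61
[::0;1;2;3;4;5;6;7;8;9;10;11;12;13;14;15;16;17]; U 61
[::0;1;2;3;4;5;7;6;8;9;10;11;12;13;14;15;16;17]; G 12; U 61
[::0;1;2;3;5;4;6;7;9;8;12;13;10;11;16;15;14;17]; U 61
[::0;1;2;3;5;4;7;6;9;8;12;13;10;11;16;15;14;17]; U 61
[::4;1;10;11;5;0;18;19;9;15;12;13;2;3;17;8;14;16]; U 61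
[::4;1;10;11;5;0;19;18;9;15;12;13;2;3;17;8;14;16]; G 12; U 61
[::0;1;2;3;5;4;6;7;9;8;12;13;10;11;16;15;14;17]; U 61
[::0;1;2;3;5;4;7;6;9;8;12;13;10;11;16;15;14;17]; U 61
[::4;1;10;11;5;0;18;19;9;15;12;13;2;3;17;8;14;16]; U 61
[::4;1;10;11;5;0;19;18;9;15;12;13;2;3;17;8;14;16]; G 6; U 61
[::0;3;2;1;9;8;6;7;5;4;14;11;16;13;10;15;12;17]; U 61
[::0;3;2;1;8;9;6;7;4;5;16;13;14;11;12;15;10;17]; K; G 6; U 61
[::0;3;2;1;9;8;6;7;5;4;14;11;16;13;10;15;12;17]; U 61
[::0;3;2;1;8;9;6;7;4;5;16;13;14;11;12;15;10;17]; G 7; U 61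
[::0;3;2;1;9;8;7;6;5;4;14;11;16;13;10;15;12;17]; U 61
[::0;3;2;1;8;9;7;6;4;5;16;13;14;11;12;15;10;17]; G 7; U 61
[::0;3;2;1;9;8;7;6;5;4;14;11;16;13;10;15;12;17]; U 61
[::0;3;2;1;8;9;7;6;4;5;16;13;14;11;12;15;10;17]; T 0 2 [::7;6]; S; G 6; U 61
[::0;3;2;1;9;8;6;7;5;4;14;11;16;13;10;15;12;17]; U 61
[::0;3;2;1;8;9;6;7;4;5;16;13;14;11;12;15;10;17]; U 62
[::0;1;2;3;5;4;6;7;9;8;12;13;10;11;16;15;14;17;21;20;19;18]; G 7; U 61
[::0;3;2;1;9;8;7;6;5;4;14;11;16;13;10;15;12;17]; U 61
[::0;3;2;1;8;9;7;6;4;5;16;13;14;11;12;15;10;17]; U 62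
[::0;1;2;3;5;4;7;6;9;8;12;13;10;11;16;15;14;17;21;20;19;18]; G 7; U 61
[::0;3;2;1;9;8;7;6;5;4;14;11;16;13;10;15;12;17]; U 61
[::0;3;2;1;8;9;7;6;4;5;16;13;14;11;12;15;10;17]; U 62
[::0;1;2;3;5;4;7;6;9;8;12;13;10;11;16;15;14;17;21;20;19;18]; T 0 2 [::7;6]; S; G 15; K; G 15; K; G
12; K; T 5 11 [::4;9;15]; K; G 16; K; T 15 11 [::4;9]; K; G 6; K; G 14; P
[::0;3;9;14;6;2;7;16;8;13;17;10;4;11;15;12;5;1]; G 17; G 18; K; G 18; G 19; G 20; G 20; T 18 2
[::6;0;7]; S; G 20; G 20; G 18; U 64 [::0;1;3;2;5;4;9;8;7;6;13;12;11;10;14;15;16;17;18;19]; G 23; G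
23; T 18 2 [::6;0;7]; S; G 14; U 65 [::1;4;5;0;10;11;12;13;3;2;17;7;15;9;6;16;8;14]; G 14; U 65
[::1;4;5;0;10;11;12;13;3;2;17;7;15;9;6;16;8;14]; G 17; U 65
[::1;5;4;0;13;12;11;10;2;3;17;8;15;6;9;16;7;18]; G 18; K; G 18; G 19; G 20; G 20; T 0 14
[::20;9;19]; G 23; G 23; T 19 1 [::0;4;5]; S; U 66
[::0;1;2;3;4;5;6;7;8;9;10;11;12;13;14;15;16;17;18;20;19;21]; G 18; U 66
[::0;1;3;2;5;4;9;8;7;6;13;12;11;10;18;15;16;17;14;19;22;21]; U 66
[::0;1;3;2;5;4;9;8;7;6;13;12;11;10;18;15;16;17;14;20;22;21]; G 19; U 66
[::4;1;10;11;0;5;17;7;15;9;2;3;13;12;14;8;16;6;21;19;20;18]; G 19; U 66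
[::4;1;10;11;0;5;17;7;15;9;2;3;13;12;14;8;16;6;21;19;20;18]; G 20; U 66
[::4;1;10;11;0;5;17;7;15;9;2;3;13;12;14;8;16;6;21;20;19;18]; G 20; U 66
[::4;1;10;11;0;5;17;7;15;9;2;3;13;12;14;8;16;6;21;20;19;18]; T 0 14 [::20;9;19]; S; T 8 11
[::4;9;15]; U 67 [::0;1;3;2;5;4;9;8;7;6;13;12;11;10;14;15;16;17]; U 67
[::0;3;2;1;9;8;7;6;5;4;14;11;16;13;10;15;12;17]; S; T 8 3 [::0;9]; U 68
[::13;5;17;8;12;1;10;14;3;16;6;15;4;0;18;11;9;2]; S; G 10; U 69
[::5;1;13;12;4;0;8;17;6;15;10;11;3;2;16;9;14;7]; U 69
[::0;1;2;3;4;5;6;7;8;9;10;11;12;13;14;15;16;17]; G 10; U 69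
[::4;1;10;11;5;0;7;18;9;15;13;12;2;3;16;6;14;8]; U 69
[::0;1;2;3;4;5;6;7;8;9;10;11;12;13;14;15;16;17]; G 18; U 69
[::3;9;8;0;14;11;16;13;1;2;18;6;15;4;7;12;5;10]; U 69
[::4;11;10;1;9;15;18;19;5;0;14;3;16;12;2;8;13;6]; G 18; U 69
[::3;9;8;0;14;11;16;13;1;2;18;6;15;4;7;12;5;10]; U 69
[::4;11;10;1;9;15;18;19;5;0;14;3;16;12;2;8;13;6]; G 19; U 69
[::3;9;8;0;14;11;16;13;1;2;19;6;15;4;7;12;5;10]; U 69
[::4;11;10;1;9;15;19;18;5;0;14;3;16;12;2;8;13;6]; G 19; U 69
[::3;9;8;0;14;11;16;13;1;2;19;6;15;4;7;12;5;10]; U 69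
[::4;11;10;1;9;15;19;18;5;0;14;3;16;12;2;8;13;6]; T 0 10 [::19;4;18]; S; U 70
[::0;1;2;3;4;5;7;6;8;9;10;11;12;13;14;15;16;17]; T 5 1 [::4;0]; T 5 3 [::9;0;8]; G 16; U 70
[::0;3;2;1;9;8;6;7;5;4;14;11;16;13;10;15;12;17]; U 70
[::0;3;2;1;9;8;7;6;5;4;14;11;16;13;10;15;12;17]; U 70
[::13;8;17;5;16;3;14;10;1;12;19;15;9;0;18;11;4;2]; S; T 0 11 [::15;4;9]; K; G 10; K; G 12; G 6; U 71
[::4;11;10;1;15;9;17;7;0;5;18;12;14;3;13;6;2;8]; U 63 [::1;5;4;0;13;12;11;10;2;3;17;8;15;6;9;16;7];
G 14; U 63 [::1;4;5;0;11;10;13;12;2;3;15;9;17;7;8;14;6]; U 71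
[::0;3;2;1;8;9;7;6;4;5;16;13;14;11;12;17;10;15]; G 14; U 63
[::1;4;5;0;11;10;13;12;2;3;15;9;17;7;8;14;6]; U 71 [::0;3;2;1;8;9;7;6;4;5;16;13;14;11;12;17;10;15];
T 9 3 [::0;8]; U 44 [::0;1;3;2;5;4;9;8;6;7;13;12;10;11]; T 5 3 [::9;0;8]; U 71
[::0;3;2;1;8;9;7;6;4;5;16;13;14;11;12;17;10;15]; S; G 12; U 72
[::4;1;10;11;0;5;19;7;15;9;2;3;13;12;14;8;18;6;16]; U 44 [::0;1;3;2;5;4;9;8;6;7;13;12;10;11]; U 44
[::1;4;0;5;11;10;3;2;13;12;9;15;19;7]; T 5 1 [::4;0]; S; U 73
[::0;1;2;3;4;5;7;6;8;9;10;11;12;13;14;15;16;17;18]; S; U 74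
[::0;3;2;1;9;8;7;6;5;4;14;11;16;13;10;15;12;17]; G 15; U 74
[::0;1;2;3;4;5;7;6;8;9;10;11;12;13;14;15;16;17]; U 74
[::0;3;2;1;9;8;7;6;5;4;14;11;16;13;10;15;12;17]; T 0 11 [::15;4;9]; K; G 10; U 74
[::0;1;2;3;5;4;7;6;9;8;12;13;10;11;16;17;14;15]; T 4 11 [::9;15]; T 0 11 [::4;9;15]; G 6; U 74
[::3;9;8;0;11;14;16;13;2;1;15;4;20;6;5;10;7;12]; U 44 [::0;3;1;2;9;8;5;4;7;6;11;14;16;13]; U 74
[::3;9;8;0;14;11;16;13;1;2;20;6;15;4;7;18;5;10]; U 74
[::3;9;8;0;14;11;16;13;1;2;20;6;15;4;7;19;5;10]; U 74
[::3;9;8;0;11;14;16;13;2;1;15;4;20;6;5;10;7;21]; U 63 [::1;4;5;0;11;10;13;12;2;3;15;9;20;7;8;14;6];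
S; U 75 [::0;1;2;3;4;5;7;6;8;9;10;11;12;13;14;15;16;17;19;18]; S; U 76
[::0;1;2;3;4;5;7;6;8;9;10;11;13;12;14;15]; U 76 [::1;0;5;4;3;2;13;12;10;11;8;9;6;7;15;14]; U 76
[::1;0;5;4;3;2;13;12;10;11;8;9;7;6;15;14]; S; U 77 [::0;1;2;3;4;5;7;6;8;9;11;10;13;12]; U 77
[::0;1;2;3;4;5;7;6;9;8;10;11;13;12]; U 77 [::0;1;2;3;4;5;7;6;9;8;11;10;13;12]; U 77
[::0;1;3;2;5;4;9;8;6;7;12;13;11;10]; U 77 [::0;1;3;2;5;4;9;8;6;7;13;12;11;10]; U 77
[::0;1;3;2;5;4;9;8;7;6;12;13;11;10]; U 77 [::0;1;3;2;5;4;9;8;7;6;13;12;11;10]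
].

End Certificate.

(** The root is a single vertex without known neighbours; calling it black is harmless because an
    embedding may exchange the colours. *)
Lemma certificate_ok : run certificate [:: Prove [:: (true, [::])]] [::].
Proof. by vm_compute. Qed.

Lemma irreducible_classification (G : cgraph) :
  v3 G -> gconnected G -> irreducible G ->
  isomorphic_to G heawood_adj \/ isomorphic_to G pappus_adj.
Proof.
move=> vG conG irrG; have /card_gt0P[x0 _] := conG.1.
have [] // := run_sound vG conG irrG _ certificate_ok.
move=> /(_ (fun=> x0)) + _; apply; split.
- by case=> [|i] [|j].
- by case=> [|[|i]].
(* The root has colour [true], and [c (+) true] is [~~ c], hence the negation. *)
- by exists (~~ ccol x0); case=> //= _; case: (ccol x0).
Qed.

(** * Descent on the number of vertices *)

Lemma reduction_card (G G' : cgraph) : reduction_step G G' -> #|G'| < #|G|.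
Proof.
case=> u [v [m [_ _ _ _ [f [finj fuv _ _ _]]]]].
rewrite -(card_codom finj); apply/proper_card/properP; split; first exact/subsetP.
by exists u => //; apply/codomP => -[x E]; have [] := fuv x; rewrite -E eqxx.
Qed.

Theorem theorem2 (G : cgraph) :
  v3 G -> gconnected G ->
  exists H : cgraph, reduces_to G H /\
    (isomorphic_to H heawood_adj \/ isomorphic_to H pappus_adj).
Proof.
have [n] := ubnP #|G|; elim: n G => // n IH G ltGn vG conG.
(* [irreducible] quantifies over all coloured graphs, so the case split and the extraction of a
   reduction from its failure are done classically. *)
have [irrG|] := classic (irreducible G).
  by exists G; split; [exact: red_refl | exact: irreducible_classification].
move=> nirr; apply: NNPP => none; apply: nirr => G' step vG' conG'; apply: none.
have [|H [red iso]] := IH G' _ vG' conG'.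
  exact: leq_trans (reduction_card step) ltGn.
by exists H; split=> //; apply: red_step red.
Qed.
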